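(* Let $\gamma>-1$, $\beta\in\mathbb{D}$ and $\eta\in\mathbb{T}$. Then the operator $C_{\hat k^\gamma_\beta,\psi_{\beta,\eta}}$ is a unitary operator on $A^2_\gamma(\mathbb{D})$.
   Context: $\mathbb{D}$ is the open unit disk and $\mathbb{T}$ the unit circle of $\mathbb{C}$; $dA$ is area measure on $\mathbb{D}$ normalized so that $\mathbb{D}$ has area $1$; $dA_\gamma(w)=(\gamma+1)(1-|w|^2)^\gamma dA(w)$. The weighted Bergman space $A^2_\gamma(\mathbb{D})$ is the Hilbert space of holomorphic functions $f$ on $\mathbb{D}$ with $\int_{\mathbb{D}}|f|^2dA_\gamma<\infty$, with inner product $\langle f,g\rangle=\int_{\mathbb{D}}f\bar g\,dA_\gamma$. Its normalized reproducing kernel at $\xi\in\mathbb{D}$ is $\hat k^\gamma_\xi(w)=\frac{(1-|\xi|^2)^{(\gamma+2)/2}}{(1-\bar\xi w)^{\gamma+2}}$ (principal branch of the power). For $\beta\in\mathbb{D}$, $\eta\in\mathbb{T}$, $\psi_{\beta,\eta}$ is the automorphism of $\mathbb{D}$ given by $\psi_{\beta,\eta}(w)=\eta\frac{w-\beta}{1-\bar\beta w}$, and $C_{\hat k^\gamma_\beta,\psi_{\beta,\eta}}f=\hat k^\gamma_\beta\,(f\circ\psi_{\beta,\eta})$ for $f\in A^2_\gamma(\mathbb{D})$. *)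

(* Defs.v *)
From HB Require Import structures.
From mathcomp Require Import all_boot all_order all_algebra.
From mathcomp Require Import all_classical all_reals all_analysis.
From mathcomp Require Export complex.
Set Implicit Arguments.
Unset Strict Implicit.
Unset Printing Implicit Defensive.

Import Order.TTheory GRing.Theory Num.Theory.
Import numFieldNormedType.Exports.
Local Open Scope classical_set_scope.
Local Open Scope ring_scope.
Local Open Scope complex_scope.

Section ComplexFunctions.
Context {R : realType}.
Implicit Types z w : R[i].

Definition cexp z : R[i] :=
  (expR (complex.Re z))%:C * (cos (complex.Im z) +i* sin (complex.Im z)).

(* The principal argument, with values in ]-pi, pi]; the value at 0 is
   meaningless. *)
Definition carg z : R :=
  let t := acos (complex.Re z / Normc.normc z) in
  if 0 <= complex.Im z then t else - t.

Definition cln z : R[i] := ln (Normc.normc z) +i* carg z.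

(* The principal branch of z ^ s, for a real exponent s and z != 0. *)
Definition cpow z (s : R) : R[i] := cexp (s%:C * cln z).

Definition disc : set R[i] := [set w | `|w| < 1].

Definition circle : set R[i] := [set w | `|w| = 1].

(* [derivable] is taken over the field R[i]: the increments are complex. *)
Definition holomorphic_on_disc (f : R[i] -> R[i]) : Prop :=
  forall w, disc w -> derivable (f : R[i]^o -> R[i]^o) w 1.

Definition eq_on_disc (f g : R[i] -> R[i]) : Prop :=
  forall w, disc w -> f w = g w.

End ComplexFunctions.

Section BergmanSpace.
Context {R : realType}.
Variable gamma : R.
Implicit Types f g : R[i] -> R[i].

Definition planar_measure := (@lebesgue_measure R \x @lebesgue_measure R)%E.

Definition point (p : R * R) : R[i] := p.1 +i* p.2.

Definition planar_disc : set (R * R) := point @^-1` disc.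

(* The density of dA_gamma with respect to the planar Lebesgue measure; the
   factor 1 / pi normalizes the area of the disc to 1. *)
Definition weight (w : R[i]) : R :=
  (gamma + 1) * (1 - Normc.normc w ^+ 2) `^ gamma / pi.

(* The integral of |f|^2 against dA_gamma, possibly infinite. *)
Definition square_integral f : \bar R :=
  \int[planar_measure]_(p in planar_disc)
    (Normc.normc (f (point p)) ^+ 2 * weight (point p))%:E.

(* The integral of a complex function against dA_gamma. *)
Definition cintegral f : R[i] :=
  Rintegral planar_measure planar_disc
    (fun p => complex.Re (f (point p)) * weight (point p)) +i*
  Rintegral planar_measure planar_disc
    (fun p => complex.Im (f (point p)) * weight (point p)).

(* The elements of the Bergman space are represented by total functions
   R[i] -> R[i], two of which are identified when they agree on the disc. *)
Definition bergman f : Prop :=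
  holomorphic_on_disc f /\ (square_integral f < +oo)%E.

Definition inner f g : R[i] := cintegral (fun w => f w * (g w)^*).

Definition bergman_norm f : R := Num.sqrt (complex.Re (inner f f)).

(* Bounded linear operators of the Bergman space into itself; the second
   conjunct says that T respects the identification of functions that agree
   on the disc. *)
Definition bounded_operator (T : (R[i] -> R[i]) -> (R[i] -> R[i])) : Prop :=
  [/\ forall f, bergman f -> bergman (T f),
      forall f g, bergman f -> bergman g -> eq_on_disc f g ->
        eq_on_disc (T f) (T g),
      forall (a : R[i]) f g, bergman f -> bergman g ->
        eq_on_disc (T (fun w => a * f w + g w))
                   (fun w => a * T f w + T g w) &
      exists M : R, forall f, bergman f ->
        bergman_norm (T f) <= M * bergman_norm f].

Definition adjoint_of (T S : (R[i] -> R[i]) -> (R[i] -> R[i])) : Prop :=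
  forall f g, bergman f -> bergman g -> inner (T f) g = inner f (S g).

Definition unitary (T : (R[i] -> R[i]) -> (R[i] -> R[i])) : Prop :=
  bounded_operator T /\
  exists S : (R[i] -> R[i]) -> (R[i] -> R[i]),
    [/\ bounded_operator S, adjoint_of T S,
        forall f, bergman f -> eq_on_disc (S (T f)) f &
        forall f, bergman f -> eq_on_disc (T (S f)) f].

Definition normalized_kernel (xi w : R[i]) : R[i] :=
  ((1 - Normc.normc xi ^+ 2) `^ ((gamma + 2) / 2))%:C
    / cpow (1 - xi^* * w) (gamma + 2).

End BergmanSpace.

Definition disc_automorphism {R : realType} (beta eta w : R[i]) : R[i] :=
  eta * ((w - beta) / (1 - beta^* * w)).

Definition weighted_composition {R : realType} (u phi f : R[i] -> R[i])
  : R[i] -> R[i] := fun w => u w * f (phi w).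

(* Main.v *)
Require Import Defs.
From HB Require Import structures.
From mathcomp Require Import all_boot all_order all_algebra.
From mathcomp Require Import all_classical all_reals all_analysis.
From mathcomp Require Import measurable_realfun complex.
From mathcomp Require Import ring lra.

(* Writing b for the conjugate of beta, |psi'(w)| = (1 - |beta|^2) / |1 - b w|^2 and
   1 - |psi w|^2 = |psi'(w)| (1 - |w|^2), so that |k w|^2 times the weight at w is
   |psi'(w)|^2 times the weight at psi w. A change of variables then makes the
   operator T an isometry. It is onto, since S f = (f / k) o psi^-1 maps the Bergman
   space into itself and T S = 1; then <T f, g> = <T f, T S g> = <f, S g>.

   The planar change of variables is reduced to one dimension by Tonelli's theorem:
   a Moebius map is a composition of affine maps and of z |-> 1/z, and each of these
   is a composition of maps that move a single real coordinate.

   The kernel is holomorphic because the complex exponential is, and because the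
   principal logarithm is its continuous inverse on the right half-plane. *)

Set Implicit Arguments.
Unset Strict Implicit.
Unset Printing Implicit Defensive.

Import Order.TTheory GRing.Theory Num.Theory.
Import numFieldNormedType.Exports.
Local Open Scope classical_set_scope.
Local Open Scope complex_scope.
Local Open Scope ring_scope.

(** * Change of variables on a measurable space *)

(** A change of variables is recorded as an identity between integrals, valid for all nonnegative
    measurable functions on the whole space ([transports]). Such identities compose with no
    injectivity or smoothness to carry along, and the default values of division at singular points
    cost only a null set. Working on the whole plane has a price: the automorphism must be followed
    outside the disc too. Off its pole it maps the complement of the disc into itself, so functions
    cut off to the disc are pulled back to functions cut off to the disc. The resulting equalities
    of [square_integral] and [inner] hold for all holomorphic functions on the disc, whether or not
    the integrals are finite. Membership in the Bergman space is then read off from them. *)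

Section density_pushforward.
Context d d' (X : measurableType d) (Y : measurableType d') (R : realType).
Variables (mu : {measure set X -> \bar R}) (phi : X -> Y) (J : X -> R).
Hypotheses (mphi : measurable_fun setT phi) (mJ : measurable_fun setT J).
Hypothesis J0 : forall x, 0 <= J x.
Local Open Scope ereal_scope.

Definition density_pushforward (A : set Y) : \bar R :=
  \int[mu]_(x in phi @^-1` A) (J x)%:E.

Let mpre A : measurable A -> measurable (phi @^-1` A).
Proof. by move=> mA; rewrite -[_ @^-1` _]setTI; exact: mphi. Qed.

Let density_pushforward0 : density_pushforward set0 = 0.
Proof. by rewrite /density_pushforward preimage_set0 integral_set0. Qed.

Let density_pushforward_ge0 A : 0 <= density_pushforward A.
Proof. by apply: integral_ge0 => x _; rewrite lee_fin. Qed.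

Let density_pushforward_sigma_additive :
  semi_sigma_additive density_pushforward.
Proof.
move=> F mF tF mUF; rewrite /density_pushforward; apply: cvg_toP.
  apply: ereal_nondecreasing_is_cvgn => m n mn.
  apply: lee_sum_nneg_natr => // k _ _; apply: integral_ge0 => /= x _.
  by rewrite lee_fin.
rewrite preimage_bigcup ge0_integral_bigcup//=.
- by move=> k; exact: mpre.
- by apply/measurable_EFinP; apply: (measurable_funS measurableT).
- by move=> x _; rewrite lee_fin.
- apply/trivIsetP => i j _ _ ij; rewrite -preimage_setI.
  by have /trivIsetP/(_ i j I I ij) -> := tF; rewrite preimage_set0.
Qed.

HB.instance Definition _ := isMeasure.Build _ _ _ density_pushforward
  density_pushforward0 density_pushforward_ge0
  density_pushforward_sigma_additive.

Import HBNNSimple.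

(** Monotone convergence on both sides reduces to simple functions, linearity to indicators, and for
    an indicator the equality is the definition of [density_pushforward]. *)
Lemma ge0_integral_density_pushforward (f : Y -> \bar R) :
  measurable_fun setT f -> (forall y, 0 <= f y) ->
  \int[density_pushforward]_y f y = \int[mu]_x (f (phi x) * (J x)%:E).
Proof.
move=> mf f0.
pose f_ := nnsfun_approx measurableT mf.
have f_cvg y : EFin \o f_ ^~ y @ \oo --> f y by exact: cvg_nnsfun_approx.
have mf_ n : measurable_fun setT (f_ n \o phi) by exact: measurableT_comp.
transitivity (limn (fun n => \int[density_pushforward]_y (f_ n y)%:E)).
  rewrite -monotone_convergence//.
  - by apply: eq_integral => y _; apply/esym/cvg_lim => //; exact: f_cvg.
  - by move=> n; exact/measurable_EFinP.
  - by move=> n y _; rewrite lee_fin.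
  - by move=> y _ m n mn; rewrite lee_fin; exact/lefP/nd_nnsfun_approx.
transitivity (limn (fun n => \int[mu]_x ((f_ n (phi x))%:E * (J x)%:E))); last first.
  rewrite -monotone_convergence//.
  - apply: eq_integral => x _; apply/cvg_lim => //.
    by apply: cvgeZr => //; exact: f_cvg.
  - move=> n; apply: emeasurable_funM; last exact/measurable_EFinP.
    by apply/measurable_EFinP; exact: mf_.
  - by move=> n y _; rewrite -EFinM lee_fin mulr_ge0.
  - move=> y _ m n mn; rewrite -!EFinM lee_fin ler_wpM2r//.
    exact/lefP/nd_nnsfun_approx.
congr (limn _); apply/funext => n.
have mpk k : measurable (f_ n @^-1` [set k]) by exact: measurable_funPTI.
transitivity (\sum_(k \in range (f_ n))
    \int[density_pushforward]_y (k * \1_(f_ n @^-1` [set k]) y)%:E).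
  under eq_integral do rewrite fimfunE -fsumEFin//.
  rewrite ge0_integral_fsum//.
  - by move=> y; exact/measurable_EFinP/measurable_funM.
  - by move=> y x _; rewrite nnfun_muleindic_ge0.
transitivity (\sum_(k \in range (f_ n))
    \int[mu]_x ((k * \1_(f_ n @^-1` [set k]) (phi x))%:E * (J x)%:E)); last first.
  rewrite -ge0_integral_fsum//.
  - apply: eq_integral => x _; rewrite [in RHS]fimfunE -fsumEFin//.
    by rewrite ge0_mule_fsuml// => k; rewrite nnfun_muleindic_ge0.
  - move=> r; apply/emeasurable_funM => /=; last exact/measurable_EFinP.
    apply/measurable_EFinP/measurable_funM => //.
    exact: (measurableT_comp (measurable_indic (mpk r)) mphi).
  - by move=> r x _; rewrite mule_ge0// ?nnfun_muleindic_ge0// lee_fin.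
apply: eq_fsbigr => k _.
(* A negative [k] has an empty level set and contributes 0 to both sums; the other scalars can be
   taken out of integrals of nonnegative functions. *)
have [k0|k0] := ltP k 0%R.
  have e : f_ n @^-1` [set k] = set0 by exact: preimage_nnfun0.
  by rewrite !integral0_eq// => x _; rewrite e indic0 mulr0 ?mul0e.
have mind : measurable_fun setT (\1_(f_ n @^-1` [set k]) : Y -> R).
  exact: measurable_indic (mpk k).
under [LHS]eq_integral do rewrite EFinM.
under [RHS]eq_integral do rewrite EFinM -muleA.
rewrite !ge0_integralZl//=.
- congr (_ * _); rewrite integral_indic// setIT [LHS]integral_mkcond.
  apply: eq_integral => x _; rewrite patchE /= indicE -EFinM.
  have -> : (x \in phi @^-1` (f_ n @^-1` [set k])) =
            (phi x \in f_ n @^-1` [set k]) by [].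
  by case: ifPn; rewrite ?mul1r ?mul0r.
- apply/emeasurable_funM => /=; last exact/measurable_EFinP.
  apply/measurable_EFinP; exact: (measurableT_comp mind mphi).
- by move=> x _; rewrite -EFinM lee_fin mulr_ge0.
- exact/measurable_EFinP.
Qed.

End density_pushforward.

(** Equivalently, [mu] is the push-forward under [phi] of the measure [J mu]; [J] plays the part of
    the absolute value of the Jacobian determinant. *)
Definition transports {R : realType} d (T : measurableType d)
    (mu : {measure set T -> \bar R}) (phi : T -> T) (J : T -> R) : Prop :=
  [/\ measurable_fun setT phi, measurable_fun setT J, forall x, 0 <= J x &
      forall f : T -> \bar R, measurable_fun setT f -> (forall x, 0 <= f x)%E ->
        (\int[mu]_x (f (phi x) * (J x)%:E) = \int[mu]_x f x)%E].

(** This is the chain rule: the identity for [phi] is applied to [f], then the one for [psi] to the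
    product of [f o phi] and [J]. *)
Lemma transports_comp {R : realType} d (T : measurableType d)
    (mu : {measure set T -> \bar R}) (phi psi : T -> T) (J K : T -> R) :
  transports mu phi J -> transports mu psi K ->
  transports mu (phi \o psi) (fun x => J (psi x) * K x).
Proof.
move=> [mphi mJ J0 phiJ] [mpsi mK K0 psiK]; split.
- exact: measurableT_comp.
- by apply: measurable_funM => //; exact: measurableT_comp.
- by move=> x; rewrite mulr_ge0.
move=> f mf f0; rewrite -(phiJ f mf f0) -(psiK (fun x => f (phi x) * (J x)%:E)%E)/=.
- by apply: eq_integral => x _; rewrite EFinM muleA.
- apply: emeasurable_funM; last exact/measurable_EFinP.
  exact: measurableT_comp.
- by move=> x; rewrite mule_ge0// lee_fin.
Qed.

Lemma eq_transports {R : realType} d (T : measurableType d)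
    (mu : {measure set T -> \bar R}) (phi psi : T -> T) (J K : T -> R) :
  phi =1 psi -> J =1 K -> transports mu phi J -> transports mu psi K.
Proof. by move=> /funext-> /funext->. Qed.

(** * The real line *)

Section inverse_square.
Context {R : realType}.
Notation lambda := (@lebesgue_measure R).

Let F (x : R) := - x^-1.
Let f (x : R) := (x ^+ 2)^-1.

Let derF (x : R) : x != 0 -> is_derive x 1 F (f x).
Proof.
move=> x0; have dV : derivable (fun x : R => x^-1) x 1 by exact: derivableV.
split; first exact: derivableN.
rewrite (deriveN dV) (deriveV x0 (@derivable_id _ _ x 1)) derive_id.
by rewrite scaleNr opprK; exact: mulr1.
Qed.

Let cf (x : R) : x != 0 -> {for x, continuous f}.
Proof.
move=> x0; rewrite /f; apply: continuousV; first by rewrite expf_neq0.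
exact: exprn_continuous.
Qed.

Let cF (x : R) : x != 0 -> {for x, continuous F}.
Proof.
by move=> x0; apply: continuousN; apply: continuousV => //.
Qed.

(** The primitive [- x^-1] tends to 0 at infinity. This computes the mass of the preimage of []0,
    c^-1]] under inversion. *)
Lemma integral_sqrV_itvy (c : R) : 0 < c ->
  (\int[lambda]_(x in `[c, +oo[) ((x ^+ 2)^-1)%:E = (c^-1)%:E)%E.
Proof.
move=> c0.
rewrite (@ge0_continuous_FTC2y R f F c 0)//.
- by rewrite /F -EFinB sub0r opprK.
- by move=> x _; rewrite invr_ge0 sqr_ge0.
- apply: continuous_in_subspaceT => x; rewrite inE/= in_itv/= andbT => cx.
  by apply: cf; rewrite gt_eqF// (lt_le_trans c0).
- rewrite -oppr0; apply: cvgN; apply/gtr0_cvgV0.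
    by near=> x; near: x; exact: nbhs_pinfty_gt.
  exact: cvg_id.
- move=> x cx; apply: (@ex_derive _ _ _ _ _ _ _ (derF _)).
  by rewrite gt_eqF// (lt_trans c0).
- by apply: cvg_at_right_filter; apply: cF; rewrite gt_eqF.
- move=> x; rewrite in_itv/= andbT => cx; rewrite derive1E.
  by apply: derive_val; apply: derF; rewrite gt_eqF// (lt_trans c0).
Unshelve. all: by end_near. Qed.

Lemma integral_sqrV_itvcc (c d : R) : 0 < c -> c < d ->
  (\int[lambda]_(x in `[c, d]) ((x ^+ 2)^-1)%:E = (c^-1 - d^-1)%:E)%E.
Proof.
move=> c0 cd.
rewrite (@continuous_FTC2 R f F c d)//.
- by rewrite /F -EFinB opprK addrC.
- apply: continuous_in_subspaceT => x; rewrite inE/= in_itv/= => /andP[cx _].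
  by apply: cf; rewrite gt_eqF// (lt_le_trans c0).
- split.
  + move=> x; rewrite in_itv/= => /andP[cx _].
    by apply: (@ex_derive _ _ _ _ _ _ _ (derF _)); rewrite gt_eqF// (lt_trans c0).
  + by apply: cvg_at_right_filter; apply: cF; rewrite gt_eqF.
  + by apply: cvg_at_left_filter; apply: cF; rewrite gt_eqF// (lt_trans c0).
- move=> x; rewrite in_itv/= => /andP[cx _]; rewrite derive1E.
  by apply: derive_val; apply: derF; rewrite gt_eqF// (lt_trans c0).
Qed.

End inverse_square.

Section line.
Context {R : realType}.
Notation lambda := (@lebesgue_measure R).
Notation mR := (measurableTypeR R).

(** Lebesgue measure is determined by its values on the intervals []a, b]], so the push-forward has
    to be compared with it there only. *)
Lemma transports_line (phi J : mR -> R) :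
  measurable_fun setT (phi : mR -> mR) -> measurable_fun setT J ->
  (forall x, 0 <= J x) ->
  (forall a b : R, (a < b)%R ->
     \int[lambda]_(x in phi @^-1` `]a, b]%classic) (J x)%:E = (b - a)%:E)%E ->
  transports lambda (phi : mR -> mR) J.
Proof.
move=> mphi mJ J0 itvE; split => // f mf f0.
rewrite -(ge0_integral_density_pushforward _ mphi mJ J0)//.
apply: eq_measure_integral => A mA _; apply/esym.
apply: lebesgue_measure_unique => //.
move=> _ [[a b] _ <-] /=; rewrite lebesgue_measure_itv/= lte_fin /density_pushforward.
case: ltP => ab; first by rewrite itvE// EFinB.
by rewrite set_itv_ge ?bnd_simp -?leNgt// preimage_set0 integral_set0.
Qed.

Lemma transports_affine (a b : R) : a != 0 ->
  transports lambda (fun x : mR => a * x + b) (fun=> `|a|).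
Proof.
move=> a0; apply: transports_line => //.
- by apply: measurable_funD => //; exact: measurable_funM.
- move=> c d cd.
  rewrite integral_cst/=; last first.
    rewrite -[_ @^-1` _]setTI.
    have : measurable_fun [set: mR] (fun x : mR => a * x + b).
      by apply: measurable_funD => //; exact: measurable_funM.
    by apply => //; exact: measurable_itv.
  case: (ltgtP a 0) a0 => // a0 _.
    have -> : (fun x => a * x + b) @^-1` `]c, d] = `[(d - b) / a, (c - b) / a[%classic.
      apply/seteqP; split => x /=; rewrite !in_itv/= ler_ndivrMr// ltr_ndivlMr//.
        by move=> /andP[? ?]; apply/andP; split; lra.
      by move=> /andP[? ?]; apply/andP; split; lra.
    rewrite lebesgue_measure_itv/= lte_fin ltr_ndivrMr// divfK ?lt_eqF//.
    rewrite ltrD2r cd -EFinB -EFinM; congr EFin.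
    by rewrite ltr0_norm//; field; rewrite lt_eqF.
  have -> : (fun x => a * x + b) @^-1` `]c, d] = `](c - b) / a, (d - b) / a]%classic.
    apply/seteqP; split => x /=; rewrite !in_itv/= ler_pdivlMr// ltr_pdivrMr//.
      by move=> /andP[? ?]; apply/andP; split; lra.
    by move=> /andP[? ?]; apply/andP; split; lra.
  rewrite lebesgue_measure_itv/= lte_fin ltr_pdivrMr// divfK ?gt_eqF//.
  rewrite ltrD2r cd -EFinB -EFinM; congr EFin.
  by rewrite gtr0_norm//; field; rewrite gt_eqF.
Qed.

(** Real powers are measurable, and [x^-1] is [x] times the power -1 of [x ^+ 2]; at 0 the factor
    [x] matches the default value [0^-1 = 0]. *)
Lemma measurable_invr : measurable_fun [set: R] (fun x : R => x^-1).
Proof.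
rewrite (_ : (fun x => _) = fun x : R => x * (x ^+ 2) `^ (-1)); last first.
  apply/funext => x; rewrite powR_inv1 ?sqr_ge0//.
  have [->|x0] := eqVneq x 0; first by rewrite invr0 mul0r.
  by field.
apply: measurable_funM => //.
by apply: (measurableT_comp (measurable_powR _)).
Qed.

Lemma measurable_sqrV : measurable_fun [set: R] (fun x : R => (x ^+ 2)^-1).
Proof. by apply: (measurableT_comp measurable_invr). Qed.

(* Extending [x |-> x^-1] by the identity on [x <= 0] makes it an involution of
   the line, so that comparing measures of intervals suffices. *)
Lemma transports_pos_inv :
  transports lambda
    (fun x : mR => if 0 < x then x^-1 else x)
    (fun x => if 0 < x then (x ^+ 2)^-1 else 1).
Proof.
have mgt0 : measurable_fun [set: mR] (fun x : mR => 0 < x).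
  exact: measurable_fun_ltr.
apply: transports_line => //.
- by apply: measurable_fun_ifT => //; exact: measurable_invr.
- by apply: measurable_fun_ifT => //; exact: measurable_sqrV.
- by move=> x; case: ifP => // _; rewrite invr_ge0 sqr_ge0.
move=> a b ab.
(* [D c] is the part on [x > 0] of the preimage of []c, b]]. For [0 <= c < b] it runs from [b^-1] to
   [c^-1], but is unbounded for [c = 0], where [c^-1] takes a default value; hence the two cases. *)
pose D (c : R) := [set x : R | 0 < x /\ c < x^-1 <= b].
have pos_itv (c : R) : 0 <= c -> c < b ->
    (\int[lambda]_(x in D c) ((x ^+ 2)^-1)%:E = (b - c)%:E)%E.
  move=> c0 cb; have b0 : 0 < b by exact: le_lt_trans cb.
  move: c0; rewrite le_eqVlt => /predU1P[c0|c0].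
    rewrite -c0 subr0 -[in RHS](invrK b) -integral_sqrV_itvy ?invr_gt0//.
    congr (integral _ _ _); apply/seteqP; split => x /=; rewrite in_itv/= andbT.
      by move=> [x0 /andP[_ ?]]; rewrite invf_ple.
    move=> bx; have x0 : 0 < x by rewrite (lt_le_trans _ bx)// invr_gt0.
    by split => //; rewrite invr_gt0 x0 invf_ple.
  rewrite -[in RHS](invrK b) -[in RHS](invrK c).
  rewrite -integral_sqrV_itvcc ?invr_gt0 ?ltf_pV2//.
  rewrite -integral_itv_bndo_bndc; last first.
    by apply/measurable_EFinP; apply: measurable_funTS; exact: measurable_sqrV.
  congr (integral _ _ _); apply/seteqP; split => x /=; rewrite in_itv/=.
    by move=> [x0 /andP[? ?]]; rewrite invf_ple ?posrE// invf_pgt ?posrE//; apply/andP.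
  move=> /andP[bx xc]; have x0 : 0 < x by rewrite (lt_le_trans _ bx)// invr_gt0.
  by split => //; rewrite invf_ple ?posrE// bx andbT -invf_pgt ?posrE.
(* []a, b]] lies in the range of the identity branch, or in that of the inversion branch, or
   straddles 0; in the last case its preimage is the union of []a, 0]] and [D 0]. *)
case: (leP b 0) => b0.
  rewrite (_ : _ @^-1` _ = `]a, b]%classic); last first.
    apply/seteqP; split => x /=; rewrite !in_itv/=; case: ifPn => // x0.
      move=> /andP[_ xb]; have := le_trans xb b0.
      by rewrite leNgt invr_gt0 x0.
    by move=> /andP[_ xb]; have := lt_le_trans x0 (le_trans xb b0); rewrite ltxx.
  under eq_integral.
    move=> x; rewrite inE/= in_itv/= => /andP[_ xb].
    rewrite ltNge (le_trans xb b0)/=.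
    over.
  by rewrite integral_cst//= mul1e lebesgue_measure_itv/= lte_fin ab EFinB.
case: (leP 0 a) => a0.
  rewrite -pos_itv//; rewrite (_ : _ @^-1` _ = D a); last first.
    apply/seteqP; split => x /=; rewrite in_itv/=; case: ifPn => //.
    - by move=> x0 /andP[ax _]; move: x0; rewrite (le_lt_trans a0 ax).
    - by move=> x0 [].
    - by move=> /negbTE x0 []; rewrite x0.
  by apply: eq_integral => x; rewrite inE/= => -[-> _].
rewrite (_ : _ @^-1` _ = `]a, 0]%classic `|` D 0); last first.
  apply/seteqP; split => x /=; rewrite !in_itv/=; case: ifPn => //.
  - by move=> x0 /andP[_ xb]; right; split => //; rewrite invr_gt0 x0.
  - by rewrite -leNgt => -> /andP[-> _]; left.
  - move=> x0 [/andP[_ /(lt_le_trans x0)]|]; first by rewrite ltxx.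
    by move=> [_ /andP[xV ->]]; rewrite (lt_trans a0 xV).
  - move=> /negbTE x0 [/andP[-> x0']|[]]; first by rewrite (le_trans x0' (ltW b0)).
    by rewrite x0.
have mD : measurable (D 0).
  rewrite (_ : D 0 = [set x : mR | 0 < x] `&` [set x | x^-1 <= b]); last first.
    apply/seteqP; split => x /=; first by move=> [? /andP[]].
    by move=> [x0 xb]; split => //; rewrite invr_gt0 x0.
  apply: measurableI; first by rewrite -[X in measurable X]setTI; exact: mgt0.
  rewrite -[X in measurable X]setTI.
  have := @measurable_fun_ler _ _ _ _ _ _ measurable_invr (@measurable_cst _ _ _ _ setT b).
  by apply.
rewrite ge0_integral_setU//=.
- rewrite [X in (_ + X)%E](_ : _ = (b - 0)%:E); last first.
    rewrite -pos_itv//.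
    by apply: eq_integral => x; rewrite inE/= => -[-> _].
  rewrite [X in (X + _)%E](_ : _ = (0 - a)%:E); first by rewrite -EFinD; congr EFin; ring.
  under eq_integral.
    move=> x; rewrite inE/= in_itv/= => /andP[_ xb].
    rewrite ltNge xb/=.
    over.
  by rewrite integral_cst//= mul1e lebesgue_measure_itv/= lte_fin a0 EFinB.
- apply/measurable_EFinP; apply: measurable_funTS.
  by apply: measurable_fun_ifT => //; exact: measurable_sqrV.
- by move=> x _; rewrite lee_fin; case: ifP => // _; rewrite invr_ge0 sqr_ge0.
- rewrite disj_set2E; apply/eqP; rewrite -subset0 => x/= [].
  by rewrite in_itv/= => /andP[_ x0] [/(le_lt_trans x0)]; rewrite ltxx.
Qed.

Lemma ge0_integral_split0 (g : R -> \bar R) : measurable_fun setT g ->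
  (forall x, 0 <= g x)%E ->
  (\int[lambda]_x g x = \int[lambda]_(x in `]-oo, 0%R[) g x +
                        \int[lambda]_(x in `]0%R, +oo[) g x)%E.
Proof.
move=> mg g0; rewrite integral_itv_bndo_bndc; last exact: measurable_funTS.
rewrite -ge0_integral_setU//=; first by rewrite -setCitvr setvU.
- by apply: measurable_funTS.
- rewrite disj_set2E; apply/eqP; rewrite -subset0 => x/= [].
  by rewrite !in_itv/= andbT => /le_lt_trans/[apply]; rewrite ltxx.
Qed.

Lemma ge0_integral_neg_itv (g : R -> \bar R) : measurable_fun setT g ->
  (forall x, 0 <= g x)%E ->
  (\int[lambda]_(x in `]-oo, 0%R[) g x = \int[lambda]_(x in `]0%R, +oo[) g (- x)%R)%E.
Proof.
move=> mg g0; have N10 : (-1 : R) != 0 by rewrite oppr_eq0 oner_eq0.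
have [_ _ _ E] := transports_affine 0 N10.
rewrite integral_mkcond -E; last 2 first.
- by apply/(measurable_restrictT _ _).1 => //; exact: measurable_funTS.
- by move=> x; rewrite patchE; case: ifP.
rewrite [RHS]integral_mkcond; apply: eq_integral => x _.
rewrite !patchE normrN1 mule1 mulN1r addr0; congr (if _ then _ else _).
by apply/idP/idP; rewrite !inE/= !in_itv/= oppr_lt0 ?andbT.
Qed.

(** The involution preserves the positive half-line, so restricting [g] to it removes the identity
    branch. *)
Lemma ge0_integral_pos_inv (g : R -> \bar R) : measurable_fun setT g ->
  (forall x, 0 <= g x)%E ->
  (\int[lambda]_(x in `]0%R, +oo[) (g (x^-1)%R * ((x ^+ 2)^-1)%:E) =
   \int[lambda]_(x in `]0%R, +oo[) g x)%E.
Proof.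
move=> mg g0; have [_ _ _ E] := transports_pos_inv.
rewrite [RHS]integral_mkcond -E; last 2 first.
- by apply/(measurable_restrictT _ _).1 => //; exact: measurable_funTS.
- by move=> x; rewrite patchE; case: ifP.
rewrite [LHS]integral_mkcond; apply: eq_integral => x _.
rewrite !patchE.
have e y : (y \in `]0%R, +oo[%classic) = (0 < y).
  by apply/idP/idP; rewrite !inE/= !in_itv/= ?andbT.
rewrite !e; case: (ltP 0 x) => x0; first by rewrite invr_gt0 x0.
by rewrite ltNge x0/= mul0e.
Qed.

(** Inversion preserves each open half-line and commutes with negation, so the negative half reduces
    to the positive one; the point 0 is null. *)
Lemma transports_inv :
  transports lambda (fun x : mR => x^-1) (fun x => (x ^+ 2)^-1).
Proof.
split.
- exact: measurable_invr.
- exact: measurable_sqrV.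
- by move=> x; rewrite invr_ge0 sqr_ge0.
move=> f mf f0.
have m1 : measurable_fun setT (fun x : R => f (x^-1)%R * ((x ^+ 2)^-1)%:E)%E.
  apply: emeasurable_funM; last by apply/measurable_EFinP; exact: measurable_sqrV.
  exact: (measurableT_comp mf measurable_invr).
have p1 (x : R) : (0 <= f (x^-1)%R * ((x ^+ 2)^-1)%:E)%E.
  by rewrite mule_ge0// lee_fin invr_ge0 sqr_ge0.
rewrite [LHS]ge0_integral_split0// [RHS]ge0_integral_split0//; congr (_ + _)%E.
  rewrite [LHS]ge0_integral_neg_itv// [RHS]ge0_integral_neg_itv//.
  have mfN : measurable_fun setT (fun x : R => f (- x)).
    by apply: (measurableT_comp mf); exact: oppr_measurable.
  rewrite -(ge0_integral_pos_inv mfN)//.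
  by apply: eq_integral => x _; rewrite sqrrN invrN.
by rewrite ge0_integral_pos_inv.
Qed.

(** By Tonelli, the change of variables happens in the inner integral over the second coordinate.
    Leaving out the null value [x = 0] admits the maps [y |-> y / x] and [y |-> - x y], which
    collapse that line. *)
Lemma transports_snd (h J : R -> R -> R) :
  measurable_fun setT (fun p : mR * mR => h p.1 p.2) ->
  measurable_fun setT (fun p : mR * mR => J p.1 p.2) ->
  (forall x y, 0 <= J x y) ->
  (forall x, x != 0 ->
     transports lambda (h x : mR -> mR) (J x)) ->
  transports (@planar_measure R) (fun p => (p.1, h p.1 p.2)) (fun p => J p.1 p.2).
Proof.
move=> mh mJ J0 hJ; split => //.
  exact: measurable_fun_pair.
move=> f mf f0.
have mfJ : measurable_fun setT (fun p : mR * mR =>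
    f (p.1, h p.1 p.2) * (J p.1 p.2)%:E)%E.
  apply: emeasurable_funM; last exact/measurable_EFinP.
  apply: (measurableT_comp mf); exact: measurable_fun_pair.
rewrite /planar_measure [LHS]fubini_tonelli1//; last first.
  by move=> p; rewrite mule_ge0// lee_fin.
rewrite [RHS]fubini_tonelli1//.
apply: ge0_ae_eq_integral => //=.
- apply: measurable_fun_fubini_tonelli_F => // p; by rewrite mule_ge0// lee_fin.
- exact: measurable_fun_fubini_tonelli_F.
- by move=> x _; apply: integral_ge0 => y _; rewrite mule_ge0// lee_fin.
- by move=> x _; apply: integral_ge0.
exists [set 0]; split => //; first exact: lebesgue_measure_set1.
move=> x /= /not_implyP[_]; apply: contra_notP => /eqP x0.
have [_ _ _ E] := hJ _ x0; rewrite /fubini_F/=.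
rewrite -(E (fun y => f (x, y)))//.
by apply: measurableT_comp.
Qed.

Lemma transports_fst (h J : R -> R -> R) :
  measurable_fun setT (fun p : mR * mR => h p.1 p.2) ->
  measurable_fun setT (fun p : mR * mR => J p.1 p.2) ->
  (forall y, transports lambda ((h ^~ y) : mR -> mR) (J ^~ y)) ->
  transports (@planar_measure R) (fun p => (h p.1 p.2, p.2)) (fun p => J p.1 p.2).
Proof.
move=> mh mJ hJ; have J0 x y : 0 <= J x y by case: (hJ y).
split => //; first exact: measurable_fun_pair.
move=> f mf f0.
have mfJ : measurable_fun setT (fun p : mR * mR =>
    f (h p.1 p.2, p.2) * (J p.1 p.2)%:E)%E.
  apply: emeasurable_funM; last exact/measurable_EFinP.
  apply: (measurableT_comp mf); exact: measurable_fun_pair.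
rewrite /planar_measure [LHS]fubini_tonelli2//; last first.
  by move=> p; rewrite mule_ge0// lee_fin.
rewrite [RHS]fubini_tonelli2//.
apply: eq_integral => y _; have [_ _ _ E] := hJ y; rewrite /fubini_G/=.
rewrite -(E (fun x => f (x, y)))//.
by apply: measurableT_comp.
Qed.

End line.

(** Replaces a composite by a closed formula that agrees with it off a null set only. Agreement
    almost everywhere does not give measurability, which is therefore asked of the new pair. *)
Lemma ae_eq_transports {R : realType} d (T : measurableType d)
    (mu : {measure set T -> \bar R}) (N : set T) (phi psi : T -> T)
    (J K : T -> R) : measurable N -> mu N = 0%E ->
  measurable_fun setT psi -> measurable_fun setT K -> (forall p, 0 <= K p) ->
  (forall p, ~ N p -> phi p = psi p /\ J p = K p) ->
  transports mu phi J -> transports mu psi K.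
Proof.
move=> mN N0 mpsi mK K0 eqp [mphi mJ J0 E]; split => // f mf f0; rewrite -(E f)//.
apply: ge0_ae_eq_integral => //=.
- apply: emeasurable_funM; last exact/measurable_EFinP.
  exact: measurableT_comp.
- apply: emeasurable_funM; last exact/measurable_EFinP.
  exact: measurableT_comp.
- by move=> p _; rewrite mule_ge0// lee_fin.
- by move=> p _; rewrite mule_ge0// lee_fin.
exists N; split => // p /= /not_implyP[_]; apply: contra_notP => Np.
by have [-> ->] := eqp _ Np.
Qed.

(** * The plane *)

Section plane.
Context {R : realType}.
Notation mR := (measurableTypeR R).

Definition planar (F : R[i] -> R[i]) (p : R * R) : R * R :=
  (complex.Re (F (Defs.point p)), complex.Im (F (Defs.point p))).

Lemma point_planar F p : Defs.point (planar F p) = F (Defs.point p).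
Proof. by rewrite /planar /Defs.point; case: (F _). Qed.

Lemma normc_sqrE (z : R[i]) : Normc.normc z ^+ 2 = complex.Re z ^+ 2 + complex.Im z ^+ 2.
Proof. by case: z => a b /=; rewrite sqr_sqrtr// addr_ge0 ?sqr_ge0. Qed.

Definition ctransports (F : R[i] -> R[i]) (J : R[i] -> R) : Prop :=
  transports (@planar_measure R) (planar F) (J \o @Defs.point R).

Lemma ctransports_comp F G J K : ctransports F J -> ctransports G K ->
  ctransports (F \o G) (fun z => J (G z) * K z).
Proof.
move=> FJ GK; apply: eq_transports (transports_comp FJ GK) => p /=.
  by rewrite /planar -!/(Defs.point _) -/(planar G p) point_planar.
by rewrite point_planar.
Qed.

(* (x, y) |-> (u, y) |-> (u, v), one coordinate at a time; the second step solves
   [u = a1 x - a2 y + b1] for [x], whence the condition on [a]. *)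
Lemma ctransports_affine_Re (a b : R[i]) : complex.Re a != 0 ->
  ctransports (fun z => a * z + b) (fun=> Normc.normc a ^+ 2).
Proof.
case: a => a1 a2; case: b => b1 b2 /= a10.
pose n := a1 ^+ 2 + a2 ^+ 2.
have n0 : n != 0 by rewrite gt_eqF// ltr_pwDl ?sqr_ge0// exprn_even_gt0.
have T1 : transports (@planar_measure R)
    (fun p => (a1 * p.1 + (b1 - a2 * p.2), p.2)) (fun=> `|a1|).
  apply: (transports_fst (h := fun x y => a1 * x + (b1 - a2 * y)) (J := fun _ _ => `|a1|)) => //.
    apply: measurable_funD; first exact: measurable_funM.
    by apply: measurable_funB => //; exact: measurable_funM.
  by move=> y; exact: transports_affine.
(* Eliminating [x] leaves [n / a1] as the coefficient of [y] in [v]; the two slopes [a1] and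
   [n / a1] multiply to [n], the squared modulus of [a]. *)
have T2 : transports (@planar_measure R)
    (fun p => (p.1, n / a1 * p.2 + (b2 + a2 / a1 * (p.1 - b1)))) (fun=> `|n / a1|).
  apply: (transports_snd (h := fun x y => n / a1 * y + (b2 + a2 / a1 * (x - b1)))
    (J := fun _ _ => `|n / a1|)) => //.
    apply: measurable_funD; first exact: measurable_funM.
    apply: measurable_funD => //; apply: measurable_funM => //.
    exact: measurable_funB.
  by move=> x _; apply: transports_affine; rewrite mulf_neq0// invr_neq0.
apply: eq_transports (transports_comp T2 T1) => -[x y] /=.
  by rewrite /planar /=; congr pair; rewrite /n; field.
rewrite sqr_sqrtr ?addr_ge0 ?sqr_ge0// -normrM -[RHS]ger0_norm ?addr_ge0 ?sqr_ge0//.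
by congr `| _ |; rewrite /n; field.
Qed.

(* A purely imaginary [i t] is [(1 + i) * ((1 + i) t / 2)]. *)
Lemma ctransports_affine (a b : R[i]) : a != 0 ->
  ctransports (fun z => a * z + b) (fun=> Normc.normc a ^+ 2).
Proof.
move=> a0; have [Rea0|] := eqVneq (complex.Re a) 0; last exact: ctransports_affine_Re.
have Ima0 : complex.Im a != 0 by move: a a0 Rea0 => [a1 a2] + /= a10; rewrite a10 eq_complex/= eqxx.
have T1 := @ctransports_affine_Re (1 +i* 1) b (oner_neq0 _).
have /ctransports_affine_Re T2 : complex.Re ((complex.Im a / 2) +i* (complex.Im a / 2)) != 0.
  by rewrite /= mulf_neq0// invr_neq0// pnatr_eq0.
have := ctransports_comp T1 (T2 0); apply: eq_transports.
  move=> p; rewrite /planar /Defs.point /=; case: a Rea0 {a0 Ima0 T2} => a1 a2 /= ->.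
  by case: b {T1} => b1 b2; rewrite addr0 /=; congr pair; field.
by move=> p /=; rewrite normc_sqrE Rea0 !sqr_sqrtr ?addr_ge0 ?sqr_ge0 ?ler01//; field.
Qed.

Lemma measurable_vline : measurable [set p : mR * mR | p.1 = 0].
Proof.
rewrite -[X in measurable X]setTI.
have := @measurable_fst _ _ mR mR measurableT [set 0] (measurable_set1 (0 : mR)).
by rewrite (_ : _ `&` _ = setT `&` [set p | p.1 = 0]).
Qed.

Lemma planar_measure_vline : (@planar_measure R) [set p | p.1 = 0] = 0%E.
Proof.
rewrite (_ : [set p | _] = [set 0] `*` setT); last first.
  by apply/seteqP; split => [[x y]|[x y]] //= [].
rewrite /planar_measure product_measure1E//=.
by rewrite [X in (X * _)%E]lebesgue_measure_set1 mul0e.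
Qed.

(* With s = y / x, inversion reads (x, s) |-> (1 / ((1 + s^2) x), - s): conjugate a
   one-dimensional inversion by the shear (x, y) |-> (x, y / x), which is only
   defined off the null line x = 0. *)
Lemma ctransports_inv : ctransports (fun z => z^-1) (fun z => (Normc.normc z ^+ 4)^-1).
Proof.
have T1 : transports (@planar_measure R)
    (fun p => (p.1, p.1^-1 * p.2 + 0)) (fun p => `|p.1^-1|).
  apply: (transports_snd (h := fun x y => x^-1 * y + 0) (J := fun x _ => `|x^-1|)) => //.
  - apply: measurable_funD => //; apply: measurable_funM => //.
    exact: (measurableT_comp measurable_invr).
  - apply: (measurableT_comp (@normr_measurable _ _)).
    exact: (measurableT_comp measurable_invr).
  - by move=> x x0; apply: transports_affine; rewrite invr_neq0.
(* Undoes the shear [T1] at the new abscissa; the minus sign accounts for the new slope [- s], since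
   [T2] keeps [s]. *)
have T3 : transports (@planar_measure R)
    (fun p => (p.1, - p.1 * p.2 + 0)) (fun p => `|- p.1|).
  apply: (transports_snd (h := fun x y => - x * y + 0) (J := fun x _ => `|- x|)) => //.
  - apply: measurable_funD => //; apply: measurable_funM => //.
    exact: measurableT_comp.
  - apply: (measurableT_comp (@normr_measurable _ _)).
    exact: measurableT_comp.
  - by move=> x x0; apply: transports_affine; rewrite oppr_eq0.
have ms : measurable_fun setT (fun p : mR * mR => 1 + p.2 ^+ 2).
  by apply: measurable_funD => //; exact: measurable_funX.
have mst : measurable_fun setT (fun p : mR * mR => (1 + p.2 ^+ 2) * p.1 + 0).
  by apply: measurable_funD => //; exact: measurable_funM.
have pos (y : R) : 0 < 1 + y ^+ 2 by rewrite ltr_pwDl ?sqr_ge0.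
have T2 : transports (@planar_measure R)
    (fun p => (((1 + p.2 ^+ 2) * p.1 + 0)^-1, p.2))
    (fun p => ((((1 + p.2 ^+ 2) * p.1 + 0)) ^+ 2)^-1 * `|1 + p.2 ^+ 2|).
  apply: (transports_fst (h := fun x y => ((1 + y ^+ 2) * x + 0)^-1)
    (J := fun x y => ((((1 + y ^+ 2) * x + 0)) ^+ 2)^-1 * `|1 + y ^+ 2|)) => //.
  - exact: (measurableT_comp measurable_invr).
  - apply: measurable_funM; last by apply: measurableT_comp.
    exact: (measurableT_comp measurable_sqrV).
  - move=> y; have := transports_affine 0 (lt0r_neq0 (pos y)).
    exact: transports_comp transports_inv.
have mfst : measurable_fun setT (fun p : mR * mR => p.1) by exact: measurable_fst.
have msnd : measurable_fun setT (fun p : mR * mR => p.2) by exact: measurable_snd.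
have mn2 : measurable_fun setT (fun p : mR * mR => p.1 ^+ 2 + p.2 ^+ 2).
  by apply: measurable_funD => //; exact: measurable_funX.
have mn2V : measurable_fun setT (fun p : mR * mR => (p.1 ^+ 2 + p.2 ^+ 2)^-1).
  exact: (measurableT_comp measurable_invr).
have T := transports_comp T3 (transports_comp T2 T1).
apply: (ae_eq_transports measurable_vline planar_measure_vline _ _ _ _ T).
- apply: measurable_fun_pair => /=.
    exact: measurable_funM.
  by apply: measurableT_comp => //; exact: measurable_funM.
- rewrite (_ : _ \o _ = (fun p => (p.1 ^+ 2 + p.2 ^+ 2)^-1 ^+ 2)); last first.
    apply/funext => p /=; rewrite -[4%N]/(2 * 2)%N exprM.
    by rewrite sqr_sqrtr ?addr_ge0 ?sqr_ge0// exprVn.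
  exact: measurable_funX.
- by move=> p /=; rewrite invr_ge0 exprn_ge0// sqrtr_ge0.
move=> [x y] /= /eqP x0; have n0 : x ^+ 2 + y ^+ 2 != 0.
  by rewrite gt_eqF// ltr_pwDl ?sqr_ge0// exprn_even_gt0.
split.
  by rewrite /planar /=; congr pair; field; rewrite x0 n0.
(* The factors of [T1], [T2], [T3] are [1 / |x|], [1 / ((1 + s^2) x^2)] and [1 / ((1 + s^2) |x|)].
   As [(1 + s^2) x^2 = |z|^2], their product is [1 / |z|^4]. *)
rewrite -[4%N]/(2 * 2)%N exprM sqr_sqrtr ?addr_ge0 ?sqr_ge0//.
rewrite normrN (gtr0_norm (pos _)) mulrCA -normrM addr0.
have e : 1 + (x^-1 * y + 0) ^+ 2 = (x ^+ 2 + y ^+ 2) / x ^+ 2 by field.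
rewrite e; set n := x ^+ 2 + y ^+ 2 in n0 *.
rewrite ger0_norm; last first.
  rewrite (_ : _ * _ = n^-1); last by field; rewrite x0 n0.
  by rewrite invr_ge0 addr_ge0// sqr_ge0.
by field; rewrite x0 n0.
Qed.

End plane.

(** * Automorphisms of the disc *)

Section mobius.
Context {R : realType}.
Notation mR := (measurableTypeR R).
Implicit Types (z w beta eta : R[i]) (p : R * R).

(* In a product, [z^*] is read in [ring_scope], as [Num.conj z]. *)
Lemma conj_conjc z : z^* = conjc z.
Proof. by []. Qed.

Lemma normc_ge0 z : 0 <= Normc.normc z.
Proof. by case: z => a b; exact: sqrtr_ge0. Qed.

Lemma discE w : disc w <-> Normc.normc w ^+ 2 < 1.
Proof.
rewrite /disc /= normc_def -(rmorph1 (real_complex R)) ltcR -normc_sqrE.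
by rewrite sqrtr_sqr ger0_norm ?normc_ge0// expr_lt1// normc_ge0.
Qed.

Lemma circleE w : circle w <-> Normc.normc w = 1.
Proof.
rewrite /circle /= normc_def -normc_sqrE sqrtr_sqr ger0_norm ?normc_ge0//.
by split=> [[]|->].
Qed.

Lemma normc_sqrM z w :
  Normc.normc (z * w) ^+ 2 = Normc.normc z ^+ 2 * Normc.normc w ^+ 2.
Proof. by rewrite Normc.normcM exprMn. Qed.

Lemma normc_sqrV z : Normc.normc (z^-1) ^+ 2 = (Normc.normc z ^+ 2)^-1.
Proof. by rewrite Normc.normcV exprVn. Qed.

Lemma normc_conj z : Normc.normc z^* = Normc.normc z.
Proof. by rewrite conj_conjc; case: z => a b /=; rewrite sqrrN. Qed.

(* [complex.normcN], like [complex.le_normcD] below, is about the alias [Rcomplex R]. *)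
Lemma normc_opp z : Normc.normc (- z) = Normc.normc z.
Proof. exact: (@complex.normcN R z). Qed.

Lemma normc_sqr_gt0 z : (0 < Normc.normc z ^+ 2) = (z != 0).
Proof.
rewrite exprn_even_gt0//=; apply/idP/idP; apply: contra => /eqP.
  by move=> ->; rewrite Normc.normc0.
by move=> /Normc.eq0_normc ->.
Qed.

Lemma mulcJ z : z * z^* = (Normc.normc z ^+ 2)%:C.
Proof.
rewrite normc_sqrE conj_conjc; case: z => a b /=.
by rewrite [LHS]/GRing.mul /=; congr Complex; ring.
Qed.

Lemma conj_denominator_neq0 beta w : disc beta -> disc w -> 1 - beta^* * w != 0.
Proof.
move=> /discE b1 /discE w1; apply/eqP => /eqP; rewrite subr_eq0 => /eqP e.
have : Normc.normc (beta^* * w) ^+ 2 < 1.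
  rewrite normc_sqrM normc_conj.
  by rewrite -[1]mulr1 ltr_pM// ?sqr_ge0.
by rewrite -e Normc.normc1 expr1n ltxx.
Qed.

(** Cleared of its denominator, this is [|1 - b w|^2 - |w - beta|^2 = (1 - |beta|^2) (1 - |w|^2)]
    with [b] the conjugate of [beta], a polynomial identity in the four real coordinates. *)
Lemma disc_automorphism_normc beta eta w : circle eta -> 1 - beta^* * w != 0 ->
  1 - Normc.normc (disc_automorphism beta eta w) ^+ 2 =
  (1 - Normc.normc beta ^+ 2) / Normc.normc (1 - beta^* * w) ^+ 2 *
  (1 - Normc.normc w ^+ 2).
Proof.
move=> /circleE e1 nz; have n0 := nz; rewrite -normc_sqr_gt0 in n0.
rewrite /disc_automorphism !normc_sqrM normc_sqrV e1 expr1n mul1r.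
apply: (mulIf (lt0r_neq0 n0)).
rewrite mulrBl divfK ?lt0r_neq0// mul1r mulrAC divfK ?lt0r_neq0//.
rewrite !normc_sqrE conj_conjc; case: beta nz {n0} => b1 b2 _; case: w => w1 w2 /=; ring.
Qed.

(** The real Jacobian determinant of a holomorphic map is the squared modulus of its derivative, by
    the Cauchy-Riemann equations; the unimodular [eta] drops out. *)
Definition disc_jacobian beta w : R :=
  ((1 - Normc.normc beta ^+ 2) / Normc.normc (1 - beta^* * w) ^+ 2) ^+ 2.

(** An equivalence, because the cut-off to the disc must be preserved under integrals over the whole
    plane: points outside must stay outside. *)
Lemma disc_disc_automorphism beta eta w : disc beta -> circle eta ->
  1 - beta^* * w != 0 -> disc (disc_automorphism beta eta w) <-> disc w.
Proof.
move=> /discE b1 he nz; rewrite !discE -!(subr_gt0 _ 1) disc_automorphism_normc//.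
by rewrite pmulr_rgt0// divr_gt0 ?subr_gt0// normc_sqr_gt0.
Qed.

(* [M] is affine o inversion o affine. It may differ from the automorphism at the
   pole, where both divide by 0; there [J] takes the junk value 0. *)
Lemma ctransports_disc_automorphism beta eta : disc beta -> circle eta ->
  exists M J, [/\ ctransports M J,
    forall w, 1 - beta^* * w != 0 ->
      M w = disc_automorphism beta eta w /\ J w = disc_jacobian beta w &
    forall w, 1 - beta^* * w = 0 -> J w = 0].
Proof.
move=> hb /circleE e1.
have eta0 : eta != 0.
  by apply/eqP => e0; move: e1; rewrite e0 Normc.normc0 => /esym/eqP; rewrite oner_eq0.
(* For [beta = 0] there is no pole and the map is a rotation; the decomposition used otherwise
   divides by the conjugate of [beta]. *)
have [->|b0] := eqVneq beta 0.
  have c0 : (0 : R[i])^* = 0 by exact: rmorph0.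
  exists (fun z => eta * z + 0), (fun=> Normc.normc eta ^+ 2); split.
  - exact: ctransports_affine.
  - move=> w _; rewrite /disc_automorphism /disc_jacobian c0 mul0r !subr0 addr0 divr1.
    by rewrite e1 Normc.normc0 Normc.normc1 expr0n/= subr0 expr1n divr1 expr1n.
  - by move=> w; rewrite c0 mul0r subr0 => /eqP; rewrite oner_eq0.
have c0 : beta^* != 0 by rewrite conjC_eq0.
have nb := conj_denominator_neq0 hb hb.
have a20 : eta * ((1 - beta^* * beta) / beta^*) != 0.
  by rewrite !mulf_neq0// invr_neq0.
have Nc0 : - beta^* != 0 by rewrite oppr_eq0.
(* With [b] the conjugate of [beta], partial fractions give [psi(w) = - eta / b + (eta (1 - b beta)
   / b) / (1 - b w)]. *)
have T := ctransports_comp (ctransports_affine (- (eta / beta^*)) a20)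
   (ctransports_comp ctransports_inv (ctransports_affine 1 Nc0)).
do 2 eexists; split; first exact: T.
- move=> w nz; split => /=.
    rewrite /disc_automorphism mulNr (addrC _ 1); field.
    by rewrite c0 nz.
  rewrite /disc_jacobian mulNr (addrC _ 1) !normc_sqrM normc_sqrV e1.
  rewrite normc_opp normc_conj.
  have -> : Normc.normc (1 - beta^* * beta) ^+ 2 = (1 - Normc.normc beta ^+ 2) ^+ 2.
    by rewrite mulrC mulcJ normc_sqrE /= oppr0 addr0 expr0n addr0.
  rewrite -[4%N]/(2 * 2)%N exprM.
  rewrite -normc_sqr_gt0 in nz; rewrite -normc_sqr_gt0 in b0.
  by field; move: nz b0 => /lt0r_neq0 + /lt0r_neq0; rewrite !sqrf_eq0 => -> ->.
- move=> w nz /=; rewrite mulNr (addrC _ 1) nz Normc.normc0 expr0n/= invr0.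
  by rewrite mul0r mulr0.
Qed.

Lemma planar_discE : @planar_disc R = [set p | p.1 ^+ 2 + p.2 ^+ 2 < 1].
Proof. by apply/seteqP; split => p /=; rewrite /planar_disc /= discE normc_sqrE. Qed.

Lemma measurable_planar_disc : measurable (@planar_disc R : set (mR * mR)).
Proof.
rewrite planar_discE -[X in measurable X]setTI.
apply: (@measurable_fun_ltr _ _ _ _ (fun p : mR * mR => p.1 ^+ 2 + p.2 ^+ 2) (cst 1)) => //.
by apply: measurable_funD; exact: measurable_funX.
Qed.

Lemma ge0_integral_disc_automorphism beta eta (g : mR * mR -> \bar R) :
  disc beta -> circle eta -> measurable_fun planar_disc g ->
  (forall p, planar_disc p -> 0 <= g p)%E ->
  (\int[@planar_measure R]_(p in planar_disc)
      (g (planar (disc_automorphism beta eta) p) * (disc_jacobian beta (Defs.point p))%:E) =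
   \int[@planar_measure R]_(p in planar_disc) g p)%E.
Proof.
move=> hb he mg g0; have [M [J [[mM mJ J0 E] MJ J00]]] := ctransports_disc_automorphism hb he.
rewrite [RHS]integral_mkcond -E; last 2 first.
- by apply/(measurable_restrictT _ _).1 => //; exact: measurable_planar_disc.
- by move=> p; rewrite patchE; case: ifPn => // /set_mem; exact: g0.
rewrite [LHS]integral_mkcond; apply: eq_integral => p _; rewrite !patchE.
(* At the pole both integrands vanish: one because the pole is outside the disc, the other because
   [J] is 0 there. *)
have [nz|nz] := eqVneq (1 - beta^* * Defs.point p) 0.
  rewrite [(J \o _) p]/= J00// mule0 memNset//= => hp.
  by have := conj_denominator_neq0 hb hp; rewrite nz eqxx.
have [Mp Jp] := MJ _ nz.
rewrite [(J \o _) p]/= Jp.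
rewrite (_ : planar M p = planar (disc_automorphism beta eta) p); last by rewrite /planar Mp.
rewrite (_ : (planar _ p \in planar_disc) = (p \in planar_disc)); last first.
  apply/idP/idP; rewrite !inE /planar_disc/= point_planar.
    by move/(disc_disc_automorphism hb he nz).
  by move=> ?; apply/(disc_disc_automorphism hb he nz).
by case: ifP => // _; rewrite mul0e.
Qed.

(* [integral] is the difference of the integrals of the positive and negative parts,
   even for a non-integrable function, so these parts can be treated separately. *)
Lemma Rintegral_disc_automorphism beta eta (g : mR * mR -> R) :
  disc beta -> circle eta -> measurable_fun planar_disc g ->
  Rintegral (@planar_measure R) planar_disc
      (fun p => g (planar (disc_automorphism beta eta) p) * disc_jacobian beta (Defs.point p)) =
  Rintegral (@planar_measure R) planar_disc g.
Proof.
move=> hb he mg; rewrite /Rintegral [in LHS]integralE [in RHS]integralE.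
have mEg : measurable_fun planar_disc (EFin \o g) by exact/measurable_EFinP.
congr (fine (_ - _)%E).
- rewrite -(ge0_integral_disc_automorphism hb he (measurable_funepos mEg))//.
  apply: eq_integral => p _; rewrite !funeposE/= -!EFin_max -EFinM.
  by rewrite maxr_pMl ?sqr_ge0// mul0r.
- rewrite -(ge0_integral_disc_automorphism hb he (measurable_funeneg mEg))//.
  apply: eq_integral => p _; rewrite !funenegE/= -!EFin_max -EFinM.
  by rewrite maxr_pMl ?sqr_ge0// mul0r mulNr.
Qed.

End mobius.

(** * The modulus of the kernel *)

Section kernel.
Context {R : realType}.
Implicit Types (z w beta eta : R[i]) (s gamma : R).

Lemma normc_real (r : R) : 0 <= r -> Normc.normc (r%:C)%C = r.
Proof. by move=> r0; rewrite /= expr0n addr0 sqrtr_sqr ger0_norm. Qed.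

Lemma normc_gt0 z : (0 < Normc.normc z) = (z != 0).
Proof. by rewrite -normc_sqr_gt0 exprn_even_gt0//= lt0r normc_ge0 andbT. Qed.

Lemma normc_cexp z : Normc.normc (cexp z) = expR (complex.Re z).
Proof.
rewrite /cexp Normc.normcM normc_real ?expR_ge0// /=.
by rewrite cos2Dsin2 sqrtr1 mulr1.
Qed.

(** For a real exponent the argument enters only the imaginary part of [s * cln z], so the choice of
    branch does not affect the modulus. *)
Lemma normc_cpow z s : z != 0 -> Normc.normc (cpow z s) = Normc.normc z `^ s.
Proof.
move=> z0; rewrite /cpow normc_cexp /cln /= mul0r subr0 /powR.
by rewrite -normc_gt0 in z0; rewrite gt_eqF.
Qed.

(** The base on the right is [|psi'(w)|]: up to a unimodular constant the kernel is a branch of the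
    power [(gamma + 2) / 2] of [psi']. *)
Lemma normc_sqr_kernel gamma beta w : disc beta -> 1 - beta^* * w != 0 ->
  Normc.normc (normalized_kernel gamma beta w) ^+ 2 =
  ((1 - Normc.normc beta ^+ 2) / Normc.normc (1 - beta^* * w) ^+ 2) `^ (gamma + 2).
Proof.
move=> /discE b1 nz; rewrite /normalized_kernel normc_sqrM normc_sqrV.
rewrite normc_cpow// normc_real ?powR_ge0//.
have e1 (a : R) : (a `^ ((gamma + 2) / 2)) ^+ 2 = a `^ (gamma + 2).
  by rewrite -powR_mulrn ?powR_ge0// -powRrM divfK ?pnatr_eq0.
have e2 (b : R) : 0 <= b -> (b `^ (gamma + 2)) ^+ 2 = (b ^+ 2) `^ (gamma + 2).
  by move=> b0; rewrite -powR_mulrn ?powR_ge0// -powRrM mulrC powRrM powR_mulrn.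
rewrite e1 e2 ?normc_ge0// [RHS]powRM ?subr_ge0 ?(ltW b1)// ?invr_ge0 ?sqr_ge0//.
congr (_ * _); move: (_ ^+ 2) (sqr_ge0 (Normc.normc (1 - beta^* * w))) => n n0.
by rewrite -powRN -(powR_inv1 n0) -powRrM mulN1r.
Qed.

(** The exponent [gamma + 2] splits. With [q = |psi'(w)|], the factor of exponent [gamma] moves the
    weight from [w] to [psi w], and [q ^+ 2] is the Jacobian. *)
Lemma kernel_weight gamma beta eta w : disc beta -> circle eta -> disc w ->
  Normc.normc (normalized_kernel gamma beta w) ^+ 2 * weight gamma w =
  weight gamma (disc_automorphism beta eta w) * disc_jacobian beta w.
Proof.
move=> hb he hw; have nz := conj_denominator_neq0 hb hw.
rewrite normc_sqr_kernel// /weight disc_automorphism_normc// /disc_jacobian.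
set q := (1 - _) / _.
have q0 : 0 < q by rewrite divr_gt0 ?normc_sqr_gt0// subr_gt0; exact/discE.
rewrite (powRM _ (ltW q0)); last by rewrite subr_ge0 ltW//; exact/discE.
rewrite powRD ?(gt_eqF q0) ?implybT// powR_mulrn ?(ltW q0)//.
set a := _ `^ gamma; set b := _ `^ gamma; ring.
Qed.

End kernel.

(** * The topology of the complex numbers *)

Section topology.
Context {R : realType}.
Notation mR := (measurableTypeR R).
Notation C := R[i]^o.
Implicit Types (z w : R[i]) (p : R * R).

Lemma complex_gt0 (e : R[i]) : 0 < e -> exists2 r : R, 0 < r & e = (r%:C)%C.
Proof.
by case: e => a b; rewrite ltcE/= => /andP[/eqP-> a0]; exists a.
Qed.

Lemma normC_lt (z : R[i]) (r : R) : (`|z| < (r%:C)%C) = (Normc.normc z < r).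
Proof. by rewrite normc_def ltcR; case: z. Qed.

Lemma le_normc_add z w : Normc.normc (z + w) <= Normc.normc z + Normc.normc w.
Proof. exact: (@complex.le_normcD R z w). Qed.

(** The norm of [R[i]] and the radii of its balls live in [R[i]]; a positive element of [R[i]] is
    real, so real radii suffice. *)
Lemma nbhs_complexP (w : C) (P : set C) :
  nbhs w P <-> exists2 e : R, 0 < e & forall z : R[i], Normc.normc (w - z) < e -> P z.
Proof.
split.
  move=> /nbhs_ballP[e /= /complex_gt0[r r0 ->] eP]; exists r => // z wz.
  by apply: eP; rewrite /ball /= normC_lt.
move=> [e e0 eP]; apply/nbhs_ballP; exists (e%:C)%C => /=; first by rewrite ltcR.
by move=> z; rewrite /ball /= normC_lt => /eP.
Qed.

Lemma normc_le (z : R[i]) : Normc.normc z <= `|complex.Re z| + `|complex.Im z|.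
Proof.
rewrite -ler_sqr ?nnegrE ?addr_ge0// ?normc_ge0// normc_sqrE.
rewrite sqrrD !real_normK ?num_real//.
by rewrite -addrA lerD2l lerDr mulrn_wge0// mulr_ge0.
Qed.

Lemma le_Re_normc (z : R[i]) : `|complex.Re z| <= Normc.normc z.
Proof.
rewrite -ler_sqr ?nnegrE// ?normc_ge0// normc_sqrE real_normK ?num_real//.
by rewrite lerDl sqr_ge0.
Qed.

Lemma le_Im_normc (z : R[i]) : `|complex.Im z| <= Normc.normc z.
Proof.
rewrite -ler_sqr ?nnegrE// ?normc_ge0// normc_sqrE real_normK ?num_real//.
by rewrite lerDr sqr_ge0.
Qed.

Lemma continuous_Re : continuous (@complex.Re R : C -> R).
Proof.
move=> w P /nbhs_ballP[e /= e0 eP]; apply/nbhs_complexP; exists e => // z wz.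
by apply: eP; rewrite /ball/= -raddfB; exact: le_lt_trans (le_Re_normc _) wz.
Qed.

Lemma continuous_Im : continuous (@complex.Im R : C -> R).
Proof.
move=> w P /nbhs_ballP[e /= e0 eP]; apply/nbhs_complexP; exists e => // z wz.
by apply: eP; rewrite /ball/= -raddfB; exact: le_lt_trans (le_Im_normc _) wz.
Qed.

Lemma continuous_Complex (T : topologicalType) (f g : T -> R) (t : T) :
  {for t, continuous f} -> {for t, continuous g} ->
  {for t, continuous (fun t => (f t +i* g t)%C : C)}.
Proof.
move=> cf cg P /nbhs_complexP[e e0 eP].
have e20 : 0 < e / 2 by rewrite divr_gt0.
move/cvgrPdist_lt : cf => /(_ _ e20) cf.
move/cvgrPdist_lt : cg => /(_ _ e20) cg.
near=> x; apply: eP; apply: le_lt_trans (normc_le _) _ => /=.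
rewrite (splitr e) ltrD//.
  by near: x; exact: cf.
by near: x; exact: cg.
Unshelve. all: by end_near. Qed.

Lemma continuous_point : continuous (@Defs.point R : R * R -> C).
Proof. by move=> p; apply: continuous_Complex; [exact: cvg_fst|exact: cvg_snd]. Qed.

Lemma open_disc : open (@disc R : set C).
Proof.
rewrite openE => w wD; apply/nbhs_complexP.
have w1 : Normc.normc w < 1 by move: wD; rewrite /disc/= -(rmorph1 (real_complex R)) normC_lt.
exists (1 - Normc.normc w) => [|z wz]; first by rewrite subr_gt0.
rewrite /disc/= -(rmorph1 (real_complex R)) normC_lt.
have := le_normc_add w (z - w); rewrite addrC subrK => /le_lt_trans; apply.
by rewrite -ltrBrDl -opprB normc_opp.
Qed.

Lemma open_planar_disc : open (@planar_disc R).
Proof. by apply: open_comp open_disc => p _; exact: continuous_point. Qed.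

(** Measurability refers to the product sigma-algebra, so [U] is written as a countable union of
    squares with rational centres and half-sides [1 / (n + 1)]; squares not inside [U] are replaced
    by the empty set. *)
Lemma open_measurable_plane (U : set (R * R)) : open U ->
  measurable (U : set (mR * mR)).
Proof.
move=> oU.
pose r n : R := n.+1%:R^-1.
pose Q n (a b : rat) : set (R * R) := ball (ratr a : R) (r n) `*` ball (ratr b : R) (r n).
have UE : U = \bigcup_n \bigcup_a \bigcup_b
    (if pselect (Q n a b `<=` U) then Q n a b else set0).
  apply/seteqP; split => p; last first.
    by move=> [n _ [a _ [b _]]]; case: pselect => // QU; exact: QU.
  move=> Up; have /nbhs_ballP[e /= e0 eU] : nbhs p U by exact: open_nbhs_nbhs.
  (* Two points of a square of half-side [r n] differ by less than [2 * r n] in each coordinate, so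
     a square around [p] stays in the ball of radius [e]. *)
  have [n ne] : exists n, r n < e / 2.
    have [n] := ltr_add_invr (y := 0) (x := e / 2) (divr_gt0 e0 (ltr0Sn _ 1)).
    by rewrite add0r; exists n.
  have rn0 : 0 < r n by rewrite invr_gt0.
  have approx (x : R) : exists a : rat, ball (ratr a : R) (r n) x.
    have : x < x + r n by rewrite ltrDl.
    move=> /rat_in_itvoo[q]; rewrite in_itv/= => /andP[xa ax]; exists q.
    by rewrite /ball/= gtr0_norm ?subr_gt0// ltrBlDl.
  have [a pa] := approx p.1; have [b pb] := approx p.2.
  exists n => //; exists a => //; exists b => //.
  case: pselect => [//|]; apply; move=> q [qa qb]; apply: eU.
  have tri (c x y : R) : ball c (r n) x -> ball c (r n) y -> ball x e y.
    move=> cx cy; apply: (@le_ball _ _ _ (r n + r n)).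
      by rewrite (splitr e) lerD// ltW.
    by apply: ball_triangle cy; exact: ball_sym.
  by split; [exact: tri pa qa|exact: tri pb qb].
rewrite [X in measurable X]UE.
apply: bigcupT_measurable => n; apply: bigcupT_measurable_rat => a.
apply: bigcupT_measurable_rat => b; case: pselect => QU; last exact: measurable0.
by apply: measurableX; exact: measurable_ball.
Qed.

End topology.

(** * Complex exponential and logarithm *)

Section holomorphy.
Context {R : realType}.
Notation C := R[i]^o.
Implicit Types (z w : R[i]).

(** Division by [h] turns the first-order estimate into the limit of the quotient. Its real moduli
    allow the exponential and the logarithm to be treated by real inequalities. *)
Lemma is_derive_complex (f : C -> C) z d :
  (forall e : R, 0 < e -> exists2 r : R, 0 < r & forall h : R[i], Normc.normc h < r ->
     Normc.normc (f (z + h) - f z - d * h) <= e * Normc.normc h) ->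
  is_derive (z : C) 1 f d.
Proof.
move=> fd; have dl : h^-1 *: (f (h *: (1 : C) + z) - f z)
    @[h --> (0 : (R[i] : numFieldType))^'] --> (d : C).
  move=> P /nbhs_complexP[e e0 eP].
  (* Half of [e], because the estimate is a large inequality and the ball asks for a strict one. *)
  have [r r0 fr] := fd (e / 2) (divr_gt0 e0 (ltr0Sn _ 1)).
  rewrite /= nbhs_simpl/= /dnbhs /within/=; apply/nbhs_complexP; exists r => // h.
  rewrite sub0r normc_opp => hr h0; apply: eP.
  have hn : 0 < Normc.normc h by rewrite normc_gt0.
  have -> : h *: (1 : C) + z = z + h by rewrite addrC; congr (_ + _); exact: mulr1.
  have -> : d - h^-1 *: (f (z + h) - f z) = - (h^-1 * (f (z + h) - f z - d * h)).
    by rewrite /GRing.scale/=; field.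
  rewrite normc_opp Normc.normcM Normc.normcV mulrC ltr_pdivrMr//.
  by apply: le_lt_trans (fr h hr) _; rewrite ltr_pM2r// ltr_pdivrMr// ltr_pMr// ltr1n.
split; first by apply/cvg_ex; exists d.
exact: cvg_lim dl.
Qed.

Lemma is_derive1_bound (f : R -> R) (d : R) : is_derive (0 : R) 1 f d ->
  forall e : R, 0 < e -> exists2 r : R, 0 < r & forall a, `|a| < r ->
    `|f a - f 0 - d * a| <= e * `|a|.
Proof.
move=> [dv fd] e e0.
have := dv; rewrite /derivable => /cvg_ex[l fl].
have ld : l = d by rewrite -fd; apply/esym/cvg_lim.
move/cvgrPdist_le : fl => /(_ _ e0).
rewrite /= /dnbhs /within/= => /nbhs_ballP[r /= r0 rP]; exists r => // a ar.
have [->|a0] := eqVneq a 0; first by rewrite mulr0 subrr subr0 !normr0 mulr0.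
have := rP a; rewrite /ball/= sub0r normrN => /(_ ar a0).
rewrite ld addr0 => H.
have -> : f a - f 0 - d * a = - (a * (d - a^-1 *: (f (a *: (1 : R)) - f 0))).
  rewrite /GRing.scale/= mulr1; field => //.
by rewrite normrN normrM mulrC ler_wpM2r.
Qed.

Lemma cexpD z w : cexp (z + w) = cexp z * cexp w.
Proof.
case: z => a b; case: w => c d; rewrite /cexp /= expRD cosD sinD.
by rewrite [LHS]/GRing.mul [RHS]/GRing.mul /=; congr Complex; ring.
Qed.

(** [cexp h = 1 + h + o(h)], obtained from the expansions at 0 of the real exponential, cosine and
    sine. *)
Lemma cexp_bound (e : R) : 0 < e -> exists2 r : R, 0 < r &
  forall h : R[i], Normc.normc h < r ->
    Normc.normc (cexp h - 1 - h) <= e * Normc.normc h.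
Proof.
(* With [n = |h| < e1 <= 1] the exponential is at most 3; the real part of the error is then at most
   [(3 + 1) * e1 * n] and the imaginary part at most [(3 + 2) * e1 * n], whence 9. *)
move=> e0; have [e1 [e10 e11 e1e]] : exists e1, [/\ 0 < e1, e1 <= 1 & 9 * e1 <= e].
  exists (Num.min (e / 9) 1); split.
  - by rewrite lt_min ltr01 andbT divr_gt0.
  - by rewrite ge_min lexx orbT.
  - by rewrite mulrC -ler_pdivlMr// ge_min lexx.
have [r1 r10 H1] := is_derive1_bound (is_derive_expR (0 : R)) e10.
have [r2 r20 H2] := is_derive1_bound (is_derive_cos (0 : R)) e10.
have [r3 r30 H3] := is_derive1_bound (is_derive_sin (0 : R)) e10.
exists (Num.min (Num.min r1 r2) (Num.min r3 e1)); first by rewrite !lt_min r10 r20 r30 e10.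
move=> h; rewrite !lt_min => /andP[/andP[h1 h2] /andP[h3 h4]].
have hR := le_Re_normc h; have hI := le_Im_normc h.
have := H1 _ (le_lt_trans hR h1); have := H2 _ (le_lt_trans hI h2).
have := H3 _ (le_lt_trans hI h3).
rewrite cos0 sin0 expR0 subr0 oppr0 mul0r subr0 !mul1r => S1 C1 E1.
apply: le_trans (normc_le _) _.
rewrite /cexp; case: h h1 h2 h3 h4 hR hI S1 C1 E1 => a b /=.
rewrite mul0r mul0r subr0 addr0 subr0.
move: (Num.sqrt _) (expR a) (cos b) (sin b) => n E c s _ _ _ ne1 an bn S1 C1 E1.
have n0 : 0 <= n by exact: le_trans an.
have e1n0 : 0 <= e1 * n by rewrite mulr_ge0// ltW.
have S2 : `|s - b| <= e1 * n by apply: le_trans S1 _; rewrite ler_wpM2l// ltW.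
have C2 : `|c - 1| <= e1 * n by apply: le_trans C1 _; rewrite ler_wpM2l// ltW.
have E2 : `|E - 1 - a| <= e1 * n by apply: le_trans E1 _; rewrite ler_wpM2l// ltW.
have e1n : e1 * n <= n by rewrite ler_piMl.
have E3 : `|E - 1| <= 2 * n.
  by have := ler_normD (E - 1 - a) a; rewrite subrK; lra.
have E4 : `|E| <= 3 by have := ler_normD (E - 1) 1; rewrite subrK normr1; lra.
have -> : E * c - 1 - a = E * (c - 1) + (E - 1 - a) by ring.
have -> : E * s - b = E * (s - b) + (E - 1) * b by ring.
have T1 : `|E * (c - 1)| <= 3 * (e1 * n) by rewrite normrM ler_pM.
have T2 : `|E * (s - b)| <= 3 * (e1 * n) by rewrite normrM ler_pM.
have T3 : `|(E - 1) * b| <= 2 * n * n by rewrite normrM ler_pM.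
have T4 : 2 * n * n <= 2 * (e1 * n) by rewrite -mulrA ler_wpM2l// ler_wpM2r// ltW.
have := ler_normD (E * (c - 1)) (E - 1 - a).
have := ler_normD (E * (s - b)) ((E - 1) * b).
have : 9 * e1 * n <= e * n by rewrite ler_wpM2r.
lra.
Qed.

(** By the addition formula the error at [z] is [cexp z] times the error at 0. *)
Lemma is_derive_cexp z : is_derive (z : C) 1 (cexp : C -> C) (cexp z).
Proof.
apply: is_derive_complex => e e0.
have N0 : 0 < Normc.normc (cexp z) by rewrite normc_cexp expR_gt0.
have [r r0 hr] := cexp_bound (divr_gt0 e0 N0).
exists r => // h /hr; rewrite mulrAC ler_pdivlMr// mulrC -Normc.normcM.
by congr (Normc.normc _ <= _); rewrite cexpD; ring.
Qed.

(** [carg] is glued from two branches of [acos] along the real axis, which hides its continuity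
    there; the arctangent shows it. Both angles have cosine [Re z / |z|] and the sign of [Im z]. *)
Lemma carg_atan z : 0 < complex.Re z -> carg z = atan (complex.Im z / complex.Re z).
Proof.
case: z => x y /= x0; rewrite /carg /=.
have cosE : x / Num.sqrt (x ^+ 2 + y ^+ 2) = cos (atan (y / x)).
  rewrite cos_atan (_ : 1 + (y / x) ^+ 2 = (x ^+ 2 + y ^+ 2) / x ^+ 2); last first.
    by field; rewrite gt_eqF.
  rewrite sqrtrM ?addr_ge0 ?sqr_ge0// sqrtrV ?sqr_ge0// sqrtr_sqr gtr0_norm//.
  by rewrite invfM invrK mulrC.
rewrite cosE; have pi0 := pi_gt0 R.
have l1 := atan_gtNpi2 (y / x); have l2 := atan_ltpi2 (y / x).
case: ifPn => y0.
  have : 0 <= atan (y / x) by rewrite -(@atan0 R) le_atan// divr_ge0// ltW.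
  move=> ?; rewrite cosK// in_itv/=; apply/andP; split => //; lra.
have : atan (y / x) <= 0.
  by rewrite -(@atan0 R) le_atan// pmulr_lle0 ?invr_gt0// ltW// ltNge.
move=> ?; rewrite cosKN ?opprK//; apply/andP; split => //; lra.
Qed.

Lemma cexp_cln z : 0 < complex.Re z -> cexp (cln z) = z.
Proof.
move=> Rz; have z0 : z != 0 by apply/eqP => e; move: Rz; rewrite e ltxx.
have n0 : 0 < Normc.normc z by rewrite normc_gt0.
rewrite /cexp /cln/= lnK ?posrE// carg_atan//.
have cosE : cos (atan (complex.Im z / complex.Re z)) = complex.Re z / Normc.normc z.
  rewrite cos_atan (_ : 1 + _ ^+ 2 = Normc.normc z ^+ 2 / complex.Re z ^+ 2); last first.
    by rewrite normc_sqrE; field; rewrite gt_eqF.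
  rewrite sqrtrM ?sqr_ge0// sqrtrV ?sqr_ge0// !sqrtr_sqr !gtr0_norm//.
  by rewrite invfM invrK mulrC.
have sinE : sin (atan (complex.Im z / complex.Re z)) = complex.Im z / Normc.normc z.
  have := atanK (complex.Im z / complex.Re z); rewrite /tan.
  move/(canRL (mulfVK _)) => ->; last first.
    by rewrite cosE mulf_neq0 ?invr_neq0 ?gt_eqF.
  by rewrite cosE mulrA divfK ?gt_eqF.
rewrite cosE sinE; move: (Normc.normc z) n0 => n n0; case: z {Rz z0 cosE sinE} => a b /=.
by rewrite /GRing.mul/= !mul0r subr0 addr0; congr Complex; rewrite mulrC divfK ?gt_eqF.
Qed.

Lemma continuous_normc : continuous (@Normc.normc R : C -> R).
Proof.
move=> w P /nbhs_ballP[e /= e0 eP]; apply/nbhs_complexP; exists e => // z wz.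
apply: eP; rewrite /ball/=; apply: le_lt_trans wz.
have H (u v : R[i]) : Normc.normc u - Normc.normc v <= Normc.normc (u - v).
  by rewrite lerBlDr -{1}(subrK v u) le_normc_add.
by rewrite ler_norml H andbT lerNl opprB -(normc_opp (w - z)) opprB H.
Qed.

Lemma near_Re_gt0 z : 0 < complex.Re z -> nbhs (z : C) [set w | 0 < complex.Re w].
Proof. by move=> Rz; apply: (@continuous_Re R z [set x | 0 < x]); exact: lt_nbhsr. Qed.

Lemma continuous_cln z : 0 < complex.Re z -> {for z, continuous (cln : C -> C)}.
Proof.
move=> Rz; have z0 : z != 0 by apply/eqP => e; move: Rz; rewrite e ltxx.
apply: (@continuous_Complex _ C (fun w => ln (Normc.normc w)) (fun w => carg w)).
  apply: continuous_comp; first exact: continuous_normc.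
  by apply: continuous_ln; rewrite normc_gt0.
rewrite /prop_for /continuous_at carg_atan//.
have : {for z, continuous (fun w : C => atan (complex.Im w / complex.Re w))}.
  apply: continuous_comp; last exact: continuous_atan.
  apply: continuousM; first exact: continuous_Im.
  by apply: continuousV; [rewrite gt_eqF|exact: continuous_Re].
apply: cvg_trans; apply: near_eq_cvg; first exact: (@nbhs_filter C z).
by apply: filterS (near_Re_gt0 Rz) => w Rw; rewrite carg_atan.
Qed.

(* If k = cln (z + h) - cln z, then h = cexp' (cln z) * k + o(k) = z * k + o(k). *)
Lemma is_derive_cln z : 0 < complex.Re z -> is_derive (z : C) 1 (cln : C -> C) z^-1.
Proof.
move=> Rz; have z0 : z != 0 by apply/eqP => e; move: Rz; rewrite e ltxx.
have n0 : 0 < Normc.normc z by rewrite normc_gt0.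
apply: is_derive_complex => e e0.
set n := Normc.normc z in n0.
(* The exponential will give [|h - z k| <= e1 |k|]. The bound [n / 2] makes this imply
   [n |k| <= 2 |h|]; the other one then yields [|h - z k| <= e n |h|], to be divided by
   [n = |z|]. *)
have [e1 [e10 e1n e1e]] : exists e1, [/\ 0 < e1, e1 <= n / 2 & e1 <= e * n ^+ 2 / 2].
  exists (Num.min (n / 2) (e * n ^+ 2 / 2)); split.
  - by rewrite lt_min !divr_gt0// mulr_gt0// exprn_gt0.
  - by rewrite ge_min lexx.
  - by rewrite ge_min lexx orbT.
have [r r0 er] := cexp_bound (divr_gt0 e10 n0).
have /nbhs_complexP[r1 r10 H1] := near_Re_gt0 Rz.
have /continuous_cln/(_ [set u | Normc.normc (cln z - u) < r]) := Rz.
have : nbhs (cln z : C) [set u | Normc.normc (cln z - u) < r].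
  by apply/nbhs_complexP; exists r.
move=> /[swap]/[apply]/nbhs_complexP[r2 r20 H2].
exists (Num.min r1 r2); first by rewrite lt_min r10.
move=> h; rewrite lt_min => /andP[h1 h2].
have E3 : Normc.normc (z - (z + h)) = Normc.normc h by rewrite opprD addNKr normc_opp.
have /H1 Rzh : Normc.normc (z - (z + h)) < r1 by rewrite E3.
have /H2/= kr : Normc.normc (z - (z + h)) < r2 by rewrite E3.
set k := cln (z + h) - cln z.
have kr' : Normc.normc k < r by rewrite -normc_opp opprB.
(* [cexp] inverts [cln] at [z] and at [z + h], both in the right half-plane by the choice of
   [r1]. *)
have hk : h = z * (cexp k - 1).
  have : cexp (cln z + k) = z + h by rewrite addrC subrK cexp_cln.
  by rewrite cexpD cexp_cln// mulrBr => ->; ring.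
have := er _ kr'; rewrite mulrAC ler_pdivlMr// -Normc.normcM.
rewrite (_ : _ * z = h - z * k); last by rewrite hk; ring.
move=> B1.
have -> : k - z^-1 * h = - (z^-1 * (h - z * k)) by field.
rewrite normc_opp Normc.normcM Normc.normcV mulrC ler_pdivrMr//.
apply: (le_trans B1).
have B2 : n * Normc.normc k <= 2 * Normc.normc h.
  have := le_normc_add h (- (h - z * k)).
  rewrite normc_opp opprB addrC subrK Normc.normcM -/n.
  have : e1 * Normc.normc k <= n / 2 * Normc.normc k by rewrite ler_wpM2r// normc_ge0.
  lra.
have B3 : e1 * Normc.normc k <= e * n / 2 * (n * Normc.normc k).
  have -> : e * n / 2 * (n * Normc.normc k) = e * n ^+ 2 / 2 * Normc.normc k by ring.
  by rewrite ler_wpM2r// normc_ge0.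
apply: le_trans B3 _.
have -> : e * Normc.normc h * n = e * n / 2 * (2 * Normc.normc h) by field.
by rewrite ler_wpM2l// !mulr_ge0// ltW.
Qed.

End holomorphy.

(** * Weighted composition operators *)

Section bergman.
Context {R : realType}.
Notation C := R[i]^o.
Notation mR := (measurableTypeR R).
Implicit Types (z w beta eta : R[i]) (f g u phi : R[i] -> R[i]).

Lemma derivable_continuous f z :
  derivable (f : C -> C) z 1 -> {for (z : C), continuous (f : C -> C)}.
Proof. by move=> /derivable1_diffP/differentiable_continuous. Qed.

Lemma derivable_comp_complex f g z : derivable (g : C -> C) z 1 ->
  derivable (f : C -> C) (g z) 1 -> derivable (f \o g : C -> C) z 1.
Proof.
move=> /derivable1_diffP dg /derivable1_diffP df; apply/derivable1_diffP.
exact: (differentiable_comp dg df).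
Qed.

Lemma derivable_affine_complex (a b : R[i]) z :
  derivable ((fun w => b - a * w) : C -> C) z 1.
Proof.
apply: (@derivableB _ _ _ (cst (b : C))); first exact: derivable_cst.
by apply: (@derivableM _ _ (cst (a : C)) id).
Qed.

Lemma derivable_disc_automorphism beta eta z : 1 - beta^* * z != 0 ->
  derivable (disc_automorphism beta eta : C -> C) z 1.
Proof.
move=> nz; rewrite /disc_automorphism.
apply: (@derivableM _ _ (cst (eta : C))); first exact: derivable_cst.
apply: (@derivableM _ _ (fun w : C => w - beta)).
  by apply: (@derivableB _ _ _ id (cst (beta : C))).
by apply: derivableV => //; exact: derivable_affine_complex.
Qed.

Lemma derivable_cpow s z : 0 < complex.Re z ->
  derivable ((fun w => cpow w s) : C -> C) z 1.
Proof.
move=> Rz; apply: (@derivable_comp_complex cexp (fun w => (s%:C)%C * cln w)).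
  apply: (@derivableM _ _ (cst ((s%:C)%C : C))); first exact: derivable_cst.
  exact: (@ex_derive _ _ _ _ _ _ _ (is_derive_cln Rz)).
exact: (@ex_derive _ _ _ _ _ _ _ (is_derive_cexp _)).
Qed.

(** Keeps the base of the power in the half-plane where the principal logarithm is
    differentiable. *)
Lemma Re_conj_denominator_gt0 beta w : disc beta -> disc w ->
  0 < complex.Re (1 - beta^* * w).
Proof.
move=> /discE b1 /discE w1.
have : Normc.normc (beta^* * w) < 1.
  rewrite -(@expr_lt1 _ 2) ?normc_ge0// normc_sqrM normc_conj.
  by rewrite -[1]mulr1 ltr_pM// ?sqr_ge0.
move=> /(le_lt_trans (le_Re_normc _)); rewrite ltr_norml => /andP[_].
by rewrite raddfB/= subr_gt0.
Qed.

Lemma holomorphic_kernel gamma beta : disc beta ->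
  holomorphic_on_disc (normalized_kernel gamma beta).
Proof.
move=> hb w hw; rewrite /normalized_kernel.
apply: (@derivableM _ _ (cst (_ : C))); first exact: derivable_cst.
have nz := conj_denominator_neq0 hb hw.
apply: derivableV.
  by rewrite -normc_gt0 normc_cpow// powR_gt0// normc_gt0.
apply: (@derivable_comp_complex (fun w => cpow w (gamma + 2))).
  exact: derivable_affine_complex.
by apply: derivable_cpow; exact: Re_conj_denominator_gt0.
Qed.

Lemma kernel_neq0 (gamma : R) beta w : disc beta -> disc w ->
  normalized_kernel gamma beta w != 0.
Proof.
move=> hb hw; have nz := conj_denominator_neq0 hb hw.
rewrite -normc_gt0 /normalized_kernel Normc.normcM Normc.normcV normc_cpow//.
rewrite normc_real ?powR_ge0// divr_gt0// powR_gt0 ?normc_gt0//.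
by rewrite subr_gt0; exact/discE.
Qed.

Lemma holomorphic_weighted_composition u phi f :
  holomorphic_on_disc u -> holomorphic_on_disc phi ->
  (forall w, disc w -> disc (phi w)) -> holomorphic_on_disc f ->
  holomorphic_on_disc (weighted_composition u phi f).
Proof.
move=> hu hphi phiD hf w hw; apply: (@derivableM _ _ (u : C -> C)); first exact: hu.
by apply: (@derivable_comp_complex f phi); [exact: hphi|exact/hf/phiD].
Qed.

(** Open rays generate the measurable sets of the line, and their preimages within the open set [D]
    are open. Continuity is local to [D], since elements of the Bergman space are arbitrary outside
    the disc. *)
Lemma continuous_measurable_plane (D : set (R * R)) (h : R * R -> R) :
  open D -> (forall p, D p -> {for p, continuous h}) ->
  measurable_fun (D : set (mR * mR)) (h : mR * mR -> R).
Proof.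
move=> oD ch; apply: (measurability _ (RGenOInfty.measurableE R)).
move=> /= _ [_ [a ->]] <-; apply: open_measurable_plane.
rewrite openE => p [Dp hp]; apply: filterI; first exact: open_nbhs_nbhs.
have ah : a < h p by move: hp; rewrite /= in_itv/= andbT.
apply: filterS (ch p Dp [set x | a < x] (lt_nbhsr ah)) => q /=.
by rewrite in_itv/= andbT.
Qed.

Lemma measurable_holomorphic_Re f : holomorphic_on_disc f ->
  measurable_fun (@planar_disc R : set (mR * mR))
    (fun p : mR * mR => complex.Re (f (Defs.point p))).
Proof.
move=> hf; apply: continuous_measurable_plane; first exact: open_planar_disc.
move=> p Dp; apply: (@continuous_comp _ C _ (fun p => f (Defs.point p))); last exact: continuous_Re.
apply: (@continuous_comp _ C C (@Defs.point R)); first exact: continuous_point.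
exact/derivable_continuous/hf.
Qed.

Lemma measurable_holomorphic_Im f : holomorphic_on_disc f ->
  measurable_fun (@planar_disc R : set (mR * mR))
    (fun p : mR * mR => complex.Im (f (Defs.point p))).
Proof.
move=> hf; apply: continuous_measurable_plane; first exact: open_planar_disc.
move=> p Dp; apply: (@continuous_comp _ C _ (fun p => f (Defs.point p))); last exact: continuous_Im.
apply: (@continuous_comp _ C C (@Defs.point R)); first exact: continuous_point.
exact/derivable_continuous/hf.
Qed.

Lemma weight_ge0 (gamma : R) w : -1 < gamma -> 0 <= weight gamma w.
Proof.
move=> g1; rewrite /weight divr_ge0 ?pi_ge0// mulr_ge0 ?powR_ge0//.
by rewrite -lerBlDr sub0r ltW.
Qed.

Lemma measurable_weight (gamma : R) (D : set (mR * mR)) :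
  measurable_fun D (fun p : mR * mR => weight gamma (Defs.point p)).
Proof.
apply: measurable_funTS; rewrite /weight.
rewrite (_ : (fun _ => _) = fun p : mR * mR =>
  (gamma + 1) * (1 - (p.1 ^+ 2 + p.2 ^+ 2)) `^ gamma / pi); last first.
  by apply/funext => p; rewrite normc_sqrE.
apply: measurable_funM => //; apply: measurable_funM => //.
apply: (measurableT_comp (measurable_powR _)).
apply: measurable_funB => //.
by apply: measurable_funD; exact: measurable_funX.
Qed.

Lemma eq_square_integral gamma f g : eq_on_disc f g ->
  square_integral gamma f = square_integral gamma g.
Proof. by move=> fg; apply: eq_integral => p; rewrite inE => /fg ->. Qed.

Lemma eq_inner gamma f g f' g' : eq_on_disc f f' -> eq_on_disc g g' ->
  inner gamma f g = inner gamma f' g'.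
Proof.
move=> ff gg; rewrite /inner /cintegral; congr Complex.
  by apply: eq_Rintegral => p; rewrite inE => Dp; rewrite ff ?gg.
by apply: eq_Rintegral => p; rewrite inE => Dp; rewrite ff ?gg.
Qed.

(** Solving [u = psi(w)] for [w] gives [conj(eta) (u + eta beta) / (1 + conj(eta beta) u)], an
    automorphism of the same family. *)
Lemma disc_automorphismK beta eta w : disc beta -> circle eta -> disc w ->
  disc_automorphism (- (eta * beta)) eta^* (disc_automorphism beta eta w) = w.
Proof.
move=> hb he hw; have nz := conj_denominator_neq0 hb hw.
have nb := conj_denominator_neq0 hb hb.
have ee : eta * eta^* = 1 by rewrite mulcJ ((circleE _).1 he) expr1n.
have e0 : eta != 0 by apply/eqP => e0; move: ee => /eqP; rewrite e0 mul0r eq_sym oner_eq0.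
have eV : eta^* = eta^-1 by rewrite -[RHS]mulr1 -ee mulKf.
rewrite /disc_automorphism rmorphN rmorphM/= eV; field.
rewrite e0 nz /= (_ : _ - _ = 1 - beta^* * beta)//; ring.
Qed.

Lemma disc_Neta beta eta : disc beta -> circle eta -> disc (- (eta * beta)).
Proof.
by move=> /discE b1 /circleE e1; apply/discE; rewrite normc_opp normc_sqrM e1 expr1n mul1r.
Qed.

Lemma circle_conj eta : circle eta -> circle eta^*.
Proof. by move=> /circleE e1; apply/circleE; rewrite normc_conj. Qed.

(** Passing to the parameters of the inverse is an involution, so this is [disc_automorphismK] for
    the inverse. *)
Lemma disc_automorphismVK beta eta w : disc beta -> circle eta -> disc w ->
  disc_automorphism beta eta (disc_automorphism (- (eta * beta)) eta^* w) = w.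
Proof.
move=> hb he hw.
have := disc_automorphismK (disc_Neta hb he) (circle_conj he) hw.
rewrite conjCK mulrN opprK mulrA (mulrC eta^*) mulcJ ((circleE _).1 he) expr1n.
by rewrite rmorph1 mul1r.
Qed.

Lemma disc_automorphism_disc beta eta w : disc beta -> circle eta -> disc w ->
  disc (disc_automorphism beta eta w).
Proof.
by move=> hb he hw; apply/disc_disc_automorphism => //; exact: conj_denominator_neq0.
Qed.

Lemma holomorphic_disc_automorphism beta eta : disc beta ->
  holomorphic_on_disc (disc_automorphism beta eta).
Proof.
by move=> hb w hw; apply: derivable_disc_automorphism; exact: conj_denominator_neq0.
Qed.

(** * Isometry of the weighted composition operator *)

Section isometry.
Variables (gamma : R) (beta eta : R[i]).
Hypotheses (hgamma : -1 < gamma) (hbeta : disc beta) (heta : circle eta).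
Let T := weighted_composition (normalized_kernel gamma beta) (disc_automorphism beta eta).

(** An equality of extended reals, so finiteness passes both ways: for [f] it puts [T f] in the
    space, and for [S f], through [T (S f) = f], it puts [S f] there. *)
Lemma square_integral_weighted_composition f : holomorphic_on_disc f ->
  square_integral gamma (T f) = square_integral gamma f.
Proof.
move=> hf; rewrite /square_integral.
rewrite -[RHS](ge0_integral_disc_automorphism hbeta heta).
- apply: eq_integral => p; rewrite inE => hp.
  rewrite point_planar -EFinM /T /weighted_composition normc_sqrM; congr EFin.
  rewrite mulrAC [_ * weight _ _](kernel_weight _ hbeta heta)//; ring.
- apply/measurable_EFinP; apply: measurable_funM; last exact: measurable_weight.
  under eq_fun do rewrite normc_sqrE.
  apply: measurable_funD; apply: measurable_funX.
    exact: measurable_holomorphic_Re.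
  exact: measurable_holomorphic_Im.
- by move=> p _; rewrite lee_fin mulr_ge0 ?sqr_ge0// weight_ge0.
Qed.

Lemma inner_weighted_composition f g :
  holomorphic_on_disc f -> holomorphic_on_disc g ->
  inner gamma (T f) (T g) = inner gamma f g.
Proof.
move=> hf hg; rewrite /inner /cintegral.
(* The kernel enters only through its squared modulus, a real factor that leaves the real and
   imaginary parts, so [kernel_weight] applies to each. *)
have TTE w : T f w * (T g w)^* = ((Normc.normc (normalized_kernel gamma beta w) ^+ 2)%:C)%C *
    (f (disc_automorphism beta eta w) * (g (disc_automorphism beta eta w))^*).
  by rewrite -mulcJ /T /weighted_composition rmorphM/=; ring.
have [mfr mfi] := (measurable_holomorphic_Re hf, measurable_holomorphic_Im hf).
have [mgr mgi] := (measurable_holomorphic_Re hg, measurable_holomorphic_Im hg).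
have Re_conj (a b : R[i]) : complex.Re (a * b^*) =
    complex.Re a * complex.Re b + complex.Im a * complex.Im b.
  by rewrite conj_conjc; case: a => ? ?; case: b => ? ? /=; ring.
have Im_conj (a b : R[i]) : complex.Im (a * b^*) =
    complex.Im a * complex.Re b - complex.Re a * complex.Im b.
  by rewrite conj_conjc; case: a => ? ?; case: b => ? ? /=; ring.
have Re_real (r : R) z : complex.Re ((r%:C)%C * z) = complex.Re z * r.
  by case: z => a b /=; ring.
have Im_real (r : R) z : complex.Im ((r%:C)%C * z) = complex.Im z * r.
  by case: z => a b /=; ring.
congr Complex.
- rewrite -[RHS](Rintegral_disc_automorphism hbeta heta); last first.
    apply: measurable_funM; last exact: measurable_weight.
    under eq_fun do rewrite Re_conj.
    by apply: measurable_funD; exact: measurable_funM.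
  apply: eq_Rintegral => p; rewrite inE => hp.
  rewrite point_planar TTE -[RHS]mulrA -(kernel_weight _ hbeta heta)// [RHS]mulrA.
  by rewrite Re_real.
- rewrite -[RHS](Rintegral_disc_automorphism hbeta heta); last first.
    apply: measurable_funM; last exact: measurable_weight.
    under eq_fun do rewrite Im_conj.
    by apply: measurable_funB; exact: measurable_funM.
  apply: eq_Rintegral => p; rewrite inE => hp.
  rewrite point_planar TTE -[RHS]mulrA -(kernel_weight _ hbeta heta)// [RHS]mulrA.
  by rewrite Im_real.
Qed.

End isometry.

Lemma bounded_weighted_composition (gamma : R) u phi :
  (forall w, disc w -> disc (phi w)) ->
  (forall f, bergman gamma f -> bergman gamma (weighted_composition u phi f)) ->
  (forall f, bergman gamma f ->
    bergman_norm gamma (weighted_composition u phi f) = bergman_norm gamma f) ->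
  bounded_operator gamma (weighted_composition u phi).
Proof.
move=> phiD uB unorm; split => //.
- by move=> f g _ _ fg w hw; rewrite /weighted_composition fg//; exact: phiD.
- by move=> a f g _ _ w hw; rewrite /weighted_composition; ring.
- by exists 1 => f hf; rewrite mul1r unorm.
Qed.

End bergman.

Theorem proposition3p1 (R : realType) (gamma : R) (beta eta : R[i])
    (hgamma : -1 < gamma) (hbeta : disc beta) (heta : circle eta) :
  unitary gamma
    (weighted_composition (normalized_kernel gamma beta)
                          (disc_automorphism beta eta)).
Proof.
set k := normalized_kernel gamma beta; set psi := disc_automorphism beta eta.
pose psi' := disc_automorphism (- (eta * beta)) eta^*.
pose T := weighted_composition k psi.
pose S := weighted_composition (fun w => (k (psi' w))^-1) psi'.
have hb' := disc_Neta hbeta heta; have he' := circle_conj heta.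
have psiD w : disc w -> disc (psi w) by exact: disc_automorphism_disc.
have psiD' w : disc w -> disc (psi' w) by exact: disc_automorphism_disc.
have hpsi' : holomorphic_on_disc psi' by exact: holomorphic_disc_automorphism.
have hk : holomorphic_on_disc k by exact: holomorphic_kernel.
have k0 w : disc w -> k w != 0 by exact: kernel_neq0.
have ST f : eq_on_disc (S (T f)) f.
  move=> w hw; rewrite /S /T /weighted_composition /psi disc_automorphismVK//.
  by rewrite mulKf//; exact/k0/psiD'.
have TS f : eq_on_disc (T (S f)) f.
  move=> w hw; rewrite /S /T /weighted_composition /psi' disc_automorphismK//.
  by rewrite mulVKf//; exact: k0.
have holoT f : holomorphic_on_disc f -> holomorphic_on_disc (T f).
  apply: (holomorphic_weighted_composition hk _ psiD).
  exact: holomorphic_disc_automorphism.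
have holoS f : holomorphic_on_disc f -> holomorphic_on_disc (S f).
  apply: (holomorphic_weighted_composition _ hpsi' psiD') => w hw.
  apply: derivableV; first exact/k0/psiD'.
  by apply: (@derivable_comp_complex R k psi'); [exact: hpsi'|exact/hk/psiD'].
have innerT f g : holomorphic_on_disc f -> holomorphic_on_disc g ->
    inner gamma (T f) (T g) = inner gamma f g by exact: inner_weighted_composition.
(* No second change of variables: [S f] and [S g] have the inner product of [T (S f) = f] and
   [T (S g) = g]. *)
have innerS f g : holomorphic_on_disc f -> holomorphic_on_disc g ->
    inner gamma (S f) (S g) = inner gamma f g.
  move=> hf hg; rewrite -(innerT _ _ (holoS _ hf) (holoS _ hg)).
  by apply: eq_inner; exact: TS.
split.
  apply: (bounded_weighted_composition psiD) => f [hf intf].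
    split; first exact: holoT.
    by rewrite (square_integral_weighted_composition hgamma hbeta heta hf).
  by rewrite /bergman_norm (innerT _ _ hf hf).
exists S; split.
- apply: (bounded_weighted_composition psiD') => f [hf intf].
    split; first exact: holoS.
    rewrite -(square_integral_weighted_composition hgamma hbeta heta (holoS _ hf)).
    by rewrite (eq_square_integral gamma (TS f)).
  by rewrite /bergman_norm (innerS _ _ hf hf).
- move=> f g [hf _] [hg _]; rewrite -(innerT _ _ hf (holoS _ hg)).
  by apply: eq_inner => [w _|w hw] //; rewrite TS.
- by move=> f _; exact: ST.
- by move=> f _; exact: TS.
Qed.
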